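(* Let $q\in\mathbb{C}_p$ satisfy $|q-1|_p<p^{-1/(p-1)}$, $q\neq1$, and let $f,g\in UD(\mathbb{Z}_p,\mathbb{C}_p)$. Then for every $z\in\mathbb{Z}_p$, $$ (f *_q g)(z)=\frac{q-1}{\log q}\, I_q^{(x)}\big(f(x)\,g(z-x)\,q^{-x}\big)-\big(f\otimes_q g'\big)(z),$$ where $I_q^{(x)}$ denotes the $p$-adic $q$-integral with respect to the variable $x$.
   Context: $p$ is a prime, $\mathbb{C}_p$ is the completion of an algebraic closure of $\mathbb{Q}_p$. The element $q\in\mathbb{C}_p$ satisfies $|q-1|_p<p^{-1/(p-1)}$, and $q^x=\exp(x\log q)$ for $x\in\mathbb{Z}_p$; $[x]=\frac{1-q^x}{1-q}$. $UD(\mathbb{Z}_p,\mathbb{C}_p)$ is the space of uniformly differentiable functions $\mathbb{Z}_p\to\mathbb{C}_p$, and $C(\mathbb{Z}_p,\mathbb{C}_p)$ the space of continuous functions. The $p$-adic $q$-integral is $I_q(f)=\lim_{N\to\infty}\frac{1}{[p^N]}\sum_{x=0}^{p^N-1}f(x)q^x$. $C_{p^n}$ is the group of $p^n$-th roots of unity in $\mathbb{C}_p$, $T_p=\bigcup_{n\ge1}C_{p^n}$, and $\sum_w$ means $\lim_{n\to\infty}\sum_{w\in C_{p^n}}$. For a principal unit $\alpha$ of $\mathbb{C}_p$ (e.g. $\alpha\in T_p$ or $\alpha=wq^{-1}$ with $w\in T_p$) let $\phi_\alpha(x)=\alpha^x$, and set $(\hat f_\alpha)_q=I_q(\phi_\alpha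 f)$. The $q$-convolution of $f,g\in UD(\mathbb{Z}_p,\mathbb{C}_p)$ is $f*_q g=\sum_w(\hat f_{wq^{-1}})_q(\hat g_{wq^{-1}})_q\,\phi_{w^{-1}}$, which lies in $UD(\mathbb{Z}_p,\mathbb{C}_p)$. Differentiation induces $UD(\mathbb{Z}_p,\mathbb{C}_p)/\{F: F'=0\}\cong C(\mathbb{Z}_p,\mathbb{C}_p)$, and the convolution $\otimes_q$ on $C(\mathbb{Z}_p,\mathbb{C}_p)$ is defined by $F'\otimes_q G'=-(F*_q G)'$ for $F,G\in UD(\mathbb{Z}_p,\mathbb{C}_p)$; thus $f\otimes_q g'=-(F*_q g)'$ where $F\in UD(\mathbb{Z}_p,\mathbb{C}_p)$ is any function with $F'=f$. *)

(* Defs.v *)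
From HB Require Import structures.
From mathcomp Require Import all_boot all_order all_algebra.
From mathcomp Require Import reals exp.
From Stdlib Require Import ClassicalEpsilon.
Set Implicit Arguments. Unset Strict Implicit. Unset Printing Implicit Defensive.
Import Order.TTheory GRing.Theory Num.Theory.
Local Open Scope ring_scope.

(* The field C_p is modelled axiomatically: K is an algebraically closed
   field of characteristic 0 with an ultrametric absolute value abs (values
   in a real field R) normalised by |p| = 1/p, complete, and in which the
   elements algebraic over Q are dense.  Such (K, abs) is exactly C_p up to
   isometric isomorphism. *)

Section Padic.
Variables (R : realType) (K : closedFieldType) (abs : K -> R) (p : nat).

Definition seq_conv (u : nat -> K) (l : K) : Prop :=
  forall eps : R, 0 < eps -> exists N : nat, forall n : nat, (N <= n)%N ->
    abs (u n - l) < eps.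

Definition seq_cauchy (u : nat -> K) : Prop :=
  forall eps : R, 0 < eps -> exists N : nat, forall m n : nat,
    (N <= m)%N -> (N <= n)%N -> abs (u m - u n) < eps.

Definition algebraicQ (y : K) : Prop :=
  exists P : {poly rat}, P != 0 /\ root (map_poly ratr P) y.

Record Cp_axioms : Prop := {
  abs_ge0 : forall x, 0 <= abs x;
  abs_eq0 : forall x, abs x = 0 <-> x = 0;
  absM : forall x y, abs (x * y) = abs x * abs y;
  abs_ultra : forall x y, abs (x + y) <= Num.max (abs x) (abs y);
  abs_p : abs (p%:R) = (p%:R)^-1;
  char0 : forall n : nat, (0 < n)%N -> n%:R != 0 :> K;
  complete : forall u, seq_cauchy u -> exists l, seq_conv u l;
  dense_algQ : forall (x : K) (eps : R), 0 < eps ->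
    exists y, algebraicQ y /\ abs (x - y) < eps }.

Definition lim_seq (u : nat -> K) : K :=
  epsilon (inhabits 0) (fun l => seq_conv u l).

Definition isZp (x : K) : Prop :=
  forall eps : R, 0 < eps -> exists n : nat, abs (x - n%:R) < eps.

Definition expK (t : K) : K :=
  lim_seq (fun n => \sum_(k < n) t ^+ k / (k`!)%:R).
Definition logK (y : K) : K :=
  lim_seq (fun n => \sum_(1 <= k < n) (-1) ^+ k.+1 * (y - 1) ^+ k / k%:R).

Definition qpow (q x : K) : K := expK (x * logK q).

Definition qbr (q x : K) : K := (1 - qpow q x) / (1 - q).

Definition binK (x : K) (k : nat) : K :=
  (\prod_(i < k) (x - i%:R)) / (k`!)%:R.

(* phi_alpha(x) = alpha^x for a principal unit alpha and x in Z_p,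
   defined by the (Mahler) binomial series sum_k binom(x,k) (alpha-1)^k *)
Definition phi (alpha x : K) : K :=
  lim_seq (fun n => \sum_(k < n) binK x k * (alpha - 1) ^+ k).

Definition qint (q : K) (f : K -> K) : K :=
  lim_seq (fun N => (\sum_(x < p ^ N) f x%:R * qpow q x%:R) / qbr q (p ^ N)%:R).

Definition UD_at (f : K -> K) (a l : K) : Prop :=
  forall eps : R, 0 < eps -> exists delta : R, 0 < delta /\
    forall x y, isZp x -> isZp y -> x != y -> abs (x - a) < delta ->
      abs (y - a) < delta -> abs ((f x - f y) / (x - y) - l) < eps.

Definition UD (f : K -> K) : Prop := forall a, isZp a -> exists l, UD_at f a l.

Definition derivK (f : K -> K) (a : K) : K :=
  epsilon (inhabits 0) (fun l => UD_at f a l).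

Definition roots_pn (n : nat) : seq K :=
  epsilon (inhabits [::])
    (fun s : seq K => uniq s /\ forall w, w \in s <-> w ^+ (p ^ n) = 1).

Definition sum_w (F : K -> K) : K :=
  lim_seq (fun n => \sum_(w <- roots_pn n) F w).

Definition fhat (q : K) (f : K -> K) (alpha : K) : K :=
  qint q (fun x => phi alpha x * f x).

Definition qconv (q : K) (f g : K -> K) (z : K) : K :=
  sum_w (fun w => fhat q f (w / q) * fhat q g (w / q) * phi w^-1 z).

Definition antider (h : K -> K) : K -> K :=
  epsilon (inhabits (fun _ => 0))
    (fun F => UD F /\ forall x, isZp x -> derivK F x = h x).

(* convolution on C(Z_p, C_p):  F' (x)_q G' = - (F *_q G)' *)
Definition qotimes (q : K) (h k : K -> K) (z : K) : K :=
  - derivK (qconv q (antider h) (antider k)) z.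

End Padic.

(* Main.v *)
Require Import Defs.
From HB Require Import structures.
From mathcomp Require Import all_boot all_order all_algebra.
From mathcomp Require Import cyclic separable cyclotomic.
From mathcomp Require Import reals exp.
From mathcomp Require Import ring lra zify.
From Stdlib Require Import ClassicalEpsilon FunctionalExtensionality.
Import Order.TTheory GRing.Theory Num.Theory.
Local Open Scope ring_scope.

(** Put P = p^N and n = z mod P.  Since p^N / [p^N] tends to
    c = (q - 1) / log q, the transform of f at w/q is c times the Volkenborn
    integral of w^x f(x), and finite Fourier inversion on Z/P turns the sum over
    C_P into c^2 W_N(n) + o(1), where W_N is P^-1 times the cyclic convolution
    of f and g on {0, ..., P-1}.  Replacing g((n - a) mod P) by g(z - a) costs
    P g'(n - a) for a > n, and sums of a continuous function over all residues
    mod P tend to 0; hence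
      f *_q g (z) = c^2 (V(z) - T_{f,g'}(z)),
    with V(z) the Volkenborn integral of f(x) g(z - x), and T_{u,v} the
    continuous extension of n |-> sum_{a <= n} u(a) v(n - a).
    On the other hand a summation by parts gives
    W_M(n + p^N) - W_M(n) = - p^N T_{F',G'}(n) + o(p^N) uniformly in M >= N,
    so (F *_q G)' = - c^2 T_{F',G'}; with F' = f and G' = g' this is the second
    term of the formula. *)

(** The factor P^-1 in W_N is the obstacle: the transforms must be known up to o(P), and an error of
    exact order P survives the division. So the transform at w in C_P is not replaced by a Riemann
    sum at level N. Since w^x is constant on residue classes mod P, it is exactly c times the finite
    Fourier transform of [block], the Volkenborn integrals of f over these classes, and [block]
    equals f + P sigma f' + o(P). The terms with sigma disappear only because a cyclic convolution
    of continuous functions tends to 0. For the derivative, the estimate over a step p^N has to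
    survive M going to infinity. A sum over the p^(M-N) blocks must therefore gain a factor
    p^-(M-N), which no termwise bound gives; [lip_sum] supplies it. Nearly all estimates concern
    sequences on the naturals, dense in Z_p, where closeness is congruence. Objects chosen by
    [epsilon] need existence proofs: roots of unity, limits, derivatives, and antiderivatives of
    continuous functions. The choice of antiderivatives does not matter, because (F *_q G)' depends
    on F' and G' only. One factor c of c^2 V is visible in the formula, the other one is hidden in
    I_q. *)

Lemma sum_ord_mul (V : nmodType) (u : nat -> V) (a b : nat) :
  \sum_(x < a * b) u x = \sum_(i < a) \sum_(j < b) u (i + a * j)%N.
Proof.
rewrite exchange_big /=; elim: b => [|b IH]; first by rewrite muln0 !big_ord0.
rewrite mulnS addnC big_split_ord /= IH big_ord_recr /=; congr (_ + _).
by apply: eq_bigr => i _; rewrite addnC.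
Qed.

Section PadicAnalysis.
Context {R : realType} {K : closedFieldType} {abs : K -> R} {p : nat}.
Hypothesis p_prime : prime p.
Hypothesis HK : Cp_axioms abs p.

(** * The ultrametric absolute value and its values on the naturals *)

Lemma p_gt0 : (0 < p)%N. Proof. exact: prime_gt0. Qed.

Lemma pXn_gt0 n : (0 < p ^ n)%N. Proof. by rewrite expn_gt0 p_gt0. Qed.

Lemma natK_neq0 n : (0 < n)%N -> n%:R != 0 :> K.
Proof. exact: char0 HK n. Qed.

Lemma pXn_neq0 n : (p ^ n)%:R != 0 :> K.
Proof. exact/natK_neq0/pXn_gt0. Qed.

Lemma abs_nneg x : 0 <= abs x.
Proof. exact: abs_ge0 HK x. Qed.

Lemma abs0 : abs 0 = 0.
Proof. exact/(abs_eq0 HK). Qed.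

Lemma abs_gt0 x : (0 < abs x) = (x != 0).
Proof.
rewrite lt_def abs_nneg andbT; congr (~~ _).
by apply/eqP/eqP => /(abs_eq0 HK).
Qed.

Lemma abs1 : abs 1 = 1.
Proof.
have h : abs 1 != 0 by rewrite gt_eqF // abs_gt0 oner_neq0.
by apply: (mulfI h); rewrite -(absM HK) !mulr1.
Qed.

Lemma absN x : abs (- x) = abs x.
Proof.
have h : abs (-1) = 1.
  apply/eqP; have: abs (-1) ^+ 2 = 1 by rewrite expr2 -(absM HK) mulrNN mulr1 abs1.
  by move/eqP; rewrite sqrf_eq1 => /orP[//|/eqP e]; have := abs_nneg (-1); rewrite e; lra.
by rewrite -mulN1r (absM HK) h mul1r.
Qed.

Lemma absBC x y : abs (x - y) = abs (y - x).
Proof. by rewrite -absN opprB. Qed.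

Lemma absX x n : abs (x ^+ n) = abs x ^+ n.
Proof. by elim: n => [|n IH]; rewrite ?expr0 ?abs1 // !exprS (absM HK) IH. Qed.

Lemma absV x : abs x^-1 = (abs x)^-1.
Proof.
have [->|x0] := eqVneq x 0; first by rewrite invr0 abs0 invr0.
have h : abs x != 0 by rewrite gt_eqF // abs_gt0.
by apply: (mulfI h); rewrite -(absM HK) !mulfV // abs1.
Qed.

Lemma absD_le x y e : abs x <= e -> abs y <= e -> abs (x + y) <= e.
Proof. by move=> hx hy; apply: le_trans (abs_ultra HK x y) _; rewrite ge_max hx. Qed.

Lemma absB_le x y e : abs x <= e -> abs y <= e -> abs (x - y) <= e.
Proof. by move=> hx hy; apply: absD_le; rewrite ?absN. Qed.

Lemma absD_lt x y e : abs x < e -> abs y < e -> abs (x + y) < e.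
Proof. by move=> hx hy; apply: le_lt_trans (abs_ultra HK x y) _; rewrite gt_max hx. Qed.

Lemma abs_chain y x z e : abs (x - y) <= e -> abs (y - z) <= e -> abs (x - z) <= e.
Proof. by move=> hx hy; rewrite -(subrK y x) -addrA; apply: absD_le. Qed.

Lemma abs_chain_lt y x z e : abs (x - y) < e -> abs (y - z) < e -> abs (x - z) < e.
Proof. by move=> hx hy; rewrite -(subrK y x) -addrA; apply: absD_lt. Qed.

Lemma absM_le x y a b : abs x <= a -> abs y <= b -> abs (x * y) <= a * b.
Proof. by move=> hx hy; rewrite (absM HK); apply: ler_pM => //; apply: abs_nneg. Qed.

Lemma absD_gt x y : abs y < abs x -> abs (x + y) = abs x.
Proof.
move=> h; apply/eqP; rewrite eq_le absD_le //=; last exact: ltW.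
rewrite leNgt; apply/negP => h2.
by have := absD_lt _ _ _ h2 (_ : abs (- y) < abs x); rewrite absN addrK ltxx => /(_ h).
Qed.

Lemma abs_sum_le (I : Type) (r : seq I) (P : pred I) (F : I -> K) e :
  0 <= e -> (forall i, P i -> abs (F i) <= e) -> abs (\sum_(i <- r | P i) F i) <= e.
Proof.
move=> e0 h; elim/big_ind: _ => //; first by rewrite abs0.
by move=> x y; apply: absD_le.
Qed.

Lemma abs_nat n : abs n%:R <= 1.
Proof.
elim: n => [|n IH]; first by rewrite abs0.
by rewrite -addn1 natrD; apply: absD_le; rewrite ?abs1.
Qed.

Definition rad (n : nat) : R := (p%:R : R) ^- n.

Lemma pR_gt1 : 1 < p%:R :> R. Proof. by rewrite ltr1n prime_gt1. Qed.
Lemma pR_gt0 : 0 < p%:R :> R. Proof. by rewrite ltr0n p_gt0. Qed.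

Lemma abs_pXn n : abs (p ^ n)%:R = rad n.
Proof. by rewrite natrX absX (abs_p HK) exprVn. Qed.

Lemma rad_gt0 n : 0 < rad n.
Proof. by rewrite invr_gt0 exprn_gt0 // pR_gt0. Qed.
Lemma rad_ge0 n : 0 <= rad n. Proof. exact/ltW/rad_gt0. Qed.

Lemma radD m n : rad (m + n) = rad m * rad n.
Proof. by rewrite /rad exprD invfM. Qed.

Lemma rad0 : rad 0 = 1. Proof. by rewrite /rad expr0 invr1. Qed.

Lemma radS n : p%:R * rad n.+1 = rad n.
Proof. by rewrite -add1n radD mulrA /rad expr1 mulfV ?mul1r // gt_eqF ?pR_gt0. Qed.

Lemma rad_le m n : (m <= n)%N -> rad n <= rad m.
Proof.
by move=> h; rewrite lef_pV2 ?posrE ?exprn_gt0 ?pR_gt0 // ler_weXn2l // ltW // pR_gt1.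
Qed.

Lemma rad_le1 n : rad n <= 1. Proof. by rewrite -rad0 rad_le. Qed.

Lemma rad_small e : 0 < e -> exists n, forall m, (n <= m)%N -> rad m <= e.
Proof.
move=> e0; have [n hn] : exists n : nat, e^-1 <= n%:R.
  by exists (Num.bound e^-1); apply/ltW/archi_boundP; rewrite invr_ge0 ltW.
exists n => m nm; apply: le_trans (rad_le _ _ nm) _.
rewrite -[e]invrK lef_pV2 ?posrE ?invr_gt0 ?exprn_gt0 ?pR_gt0 //.
apply: le_trans hn _; rewrite -natrX ler_nat.
by apply/ltnW/ltn_expl/prime_gt1.
Qed.

(** By Bézout a p = b n + 1. If n had absolute value below 1, the right side would have absolute
    value 1, while the left side has at most 1/p. *)
Lemma abs_coprime n : coprime p n -> abs n%:R = 1.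
Proof.
move=> cop; apply/eqP; rewrite eq_le abs_nat /= leNgt; apply/negP => h.
have [a b e _] := egcdnP n p_gt0; move: e; rewrite (eqP cop) => e.
have : abs ((b * n + 1)%:R : K) <= abs (p%:R : K).
  by rewrite -e natrM (absM HK) ler_piMl ?abs_nat ?abs_nneg.
have lt1 : abs ((b * n)%:R : K) < 1.
  by rewrite natrM (absM HK); apply: le_lt_trans h; rewrite ler_piMl ?abs_nat ?abs_nneg.
rewrite natrD addrC absD_gt abs1 // (abs_p HK) => h1.
have : (p%:R : R)^-1 < 1 by rewrite invf_lt1 ?pR_gt0 // pR_gt1.
by rewrite ltNge h1.
Qed.

Lemma abs_dvd k n : (abs n%:R <= rad k) = (p ^ k %| n)%N.
Proof.
have [->|n0] := posnP n; first by rewrite abs0 rad_ge0 dvdn0.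
have [m cop ->] := pfactor_coprime p_prime n0.
rewrite natrM (absM HK) abs_coprime // mul1r abs_pXn.
rewrite pfactor_dvdn // ?muln_gt0 ?pXn_gt0 ?andbT; last first.
  by case: m cop => //; rewrite /coprime gcdn0; case: p p_prime => [|[]].
rewrite logn_Gauss // pfactorK //.
rewrite /rad lef_pV2 ?posrE ?exprn_gt0 ?pR_gt0 //.
by rewrite ler_eXn2l // pR_gt1.
Qed.

Lemma abs_natB k m n : (m <= n)%N ->
  (abs (m%:R - n%:R) <= rad k) = (m == n %[mod p ^ k])%N.
Proof. by move=> mn; rewrite absBC -natrB // abs_dvd eq_sym eqn_mod_dvd. Qed.

Lemma abs_mod k m n : (abs (m%:R - n%:R) <= rad k) = (m == n %[mod p ^ k])%N.
Proof.
by case: (leqP m n) => [/abs_natB //|/ltnW/abs_natB h]; rewrite absBC eq_sym -h.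
Qed.

(** * Limits of sequences *)

Local Notation conv := (seq_conv abs).

Lemma conv_le u l e : conv u l -> 0 < e ->
  exists N, forall n, (N <= n)%N -> abs (u n - l) <= e.
Proof. by move=> h /h [N hN]; exists N => n /hN/ltW. Qed.

Lemma convI u l :
  (forall e, 0 < e -> exists N, forall n, (N <= n)%N -> abs (u n - l) <= e) -> conv u l.
Proof.
move=> h e e0; have [N hN] := h (e / 2) ltac:(by lra).
by exists N => n /hN h1; apply: le_lt_trans h1 _; lra.
Qed.

Lemma abs_le0 x : (forall e, 0 < e -> abs x <= e) -> x = 0.
Proof.
move=> h; apply/eqP/negPn/negP => x0.
have a0 : 0 < abs x by rewrite abs_gt0.
by have := h (abs x / 2) ltac:(by lra); lra.
Qed.

Lemma conv_le_lim u l x e N : conv u l -> 0 < e ->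
  (forall n, (N <= n)%N -> abs (u n - x) <= e) -> abs (l - x) <= e.
Proof.
move=> hu e0 h; have [M hM] := conv_le _ _ _ hu e0.
apply: (abs_chain (u (maxn N M))); last by apply: h; rewrite leq_maxl.
by rewrite absBC; apply: hM; rewrite leq_maxr.
Qed.

Lemma conv_uniq u a b : conv u a -> conv u b -> a = b.
Proof.
move=> ha hb; apply/eqP; rewrite -subr_eq0; apply/eqP/abs_le0 => e e0.
have [M hM] := conv_le _ _ _ ha e0.
by rewrite absBC; apply: conv_le_lim hb e0 hM.
Qed.

Lemma limE u l : conv u l -> lim_seq abs u = l.
Proof.
move=> h; apply: conv_uniq (h); rewrite /lim_seq.
by apply: (epsilon_spec (inhabits 0) (fun l => conv u l)); exists l.
Qed.

Lemma lim_conv u : (exists l, conv u l) -> conv u (lim_seq abs u).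
Proof. by case=> l h; rewrite (limE _ _ h). Qed.

Lemma cauchy_conv u :
  (forall e, 0 < e -> exists N, forall n, (N <= n)%N -> abs (u n.+1 - u n) <= e) ->
  exists l, conv u l.
Proof.
move=> h; apply: (complete HK) => e e0; have [N hN] := h (e / 2) ltac:(by lra).
have key n : (N <= n)%N -> abs (u n - u N) <= e / 2.
  elim: n => [|n IH]; first by rewrite leqn0 => /eqP ->; rewrite subrr abs0; lra.
  rewrite leq_eqVlt => /predU1P[->|]; first by rewrite subrr abs0; lra.
  by rewrite ltnS => Nn; apply: (abs_chain (u n)); [apply: hN | apply: IH].
exists N => m n /key hm /key hn; apply: (@le_lt_trans _ _ (e / 2)); last by lra.
by apply: (abs_chain (u N)) => //; rewrite absBC.
Qed.

Lemma conv_cst c : conv (fun _ => c) c.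
Proof. by move=> e e0; exists 0%N => n _; rewrite subrr abs0. Qed.

Lemma conv_eq u v l N : (forall n, (N <= n)%N -> u n = v n) -> conv u l -> conv v l.
Proof.
move=> h hu e /hu [M hM]; exists (maxn N M) => n; rewrite geq_max => /andP[n1 n2].
by rewrite -h //; apply: hM.
Qed.

Lemma convD u v a b : conv u a -> conv v b -> conv (fun n => u n + v n) (a + b).
Proof.
move=> hu hv e e0; have [N hN] := hu e e0; have [M hM] := hv e e0.
exists (maxn N M) => n; rewrite geq_max => /andP[n1 n2].
by rewrite opprD addrACA; apply: absD_lt; [apply: hN | apply: hM].
Qed.

Lemma convN u a : conv u a -> conv (fun n => - u n) (- a).
Proof. by move=> hu e /hu [N hN]; exists N => n /hN; rewrite -opprD absN. Qed.

Lemma convB u v a b : conv u a -> conv v b -> conv (fun n => u n - v n) (a - b).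
Proof. by move=> hu hv; apply: convD => //; apply: convN. Qed.

Lemma convZ u a c : conv u a -> conv (fun n => c * u n) (c * a).
Proof.
move=> hu; apply: convI => e e0.
have B0 := abs_nneg c.
have [N hN] := conv_le u a (e / (abs c + 1)) hu ltac:(by apply: divr_gt0; lra).
exists N => n /hN; rewrite -mulrBr => h; rewrite (absM HK).
apply: le_trans (ler_wpM2l B0 h) _.
by rewrite mulrCA ler_piMr ?ltW // ltr_pdivrMr; lra.
Qed.

Lemma conv_abs_bound u a : conv u a -> exists N, forall n, (N <= n)%N -> abs (u n) <= abs a + 1.
Proof.
move=> hu; have [N hN] := conv_le u a 1 hu ltr01.
have a0 := abs_nneg a.
exists N => n /hN h; rewrite -(subrK a (u n)); apply: absD_le; lra.
Qed.

Lemma convM u v a b : conv u a -> conv v b -> conv (fun n => u n * v n) (a * b).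
Proof.
move=> hu hv; apply: convI => e e0.
have [N hN] := conv_abs_bound _ _ hu; set B := abs a + 1 in hN.
have B0 : 0 < B by have := abs_nneg a; rewrite /B; lra.
have b0 := abs_nneg b.
have [N1 h1] := conv_le u a (e / (abs b + 1)) hu ltac:(by apply: divr_gt0; lra).
have [N2 h2] := conv_le v b (e / B) hv ltac:(by apply: divr_gt0; lra).
exists (maxn N (maxn N1 N2)) => n; rewrite !geq_max => /and3P[n0 n1 n2].
have -> : u n * v n - a * b = u n * (v n - b) + (u n - a) * b by ring.
apply: absD_le.
  by apply: le_trans (absM_le _ _ _ _ (hN _ n0) (h2 _ n2)) _; rewrite mulrC divfK // gt_eqF.
apply: le_trans (absM_le _ _ _ _ (h1 _ n1) (lexx _)) _.
by rewrite mulrAC ler_pdivrMr; last lra; rewrite ler_pM2l //; lra.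
Qed.

Lemma conv_sum (I : Type) (r : seq I) (u : I -> nat -> K) (a : I -> K) :
  (forall i, conv (u i) (a i)) ->
  conv (fun n => \sum_(i <- r) u i n) (\sum_(i <- r) a i).
Proof.
move=> h; elim: r => [|i r IH].
  by apply: (conv_eq (fun _ => 0) _ _ 0) => [n _|]; rewrite big_nil //; apply: conv_cst.
rewrite big_cons; apply: (conv_eq (fun n => u i n + \sum_(j <- r) u j n) _ _ 0).
  by move=> n _; rewrite big_cons.
exact: convD.
Qed.

Lemma conv_shift u l k : conv (fun n => u (n + k)%N) l <-> conv u l.
Proof.
split=> h e /h [N hN].
  by exists (N + k)%N => n hn; have := hN (n - k)%N; rewrite subnK; [apply; lia | lia].
by exists N => n hn; apply: hN; lia.
Qed.

Lemma convV u a : a != 0 -> conv u a -> conv (fun n => (u n)^-1) a^-1.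
Proof.
move=> a0 hu; apply: convI => e e0.
have A0 : 0 < abs a by rewrite abs_gt0.
have [N hN] := hu (abs a) A0.
have e1 : 0 < e * abs a ^+ 2 by rewrite mulr_gt0 // exprn_gt0.
have [M hM] := conv_le u a _ hu e1.
exists (maxn N M) => n; rewrite geq_max => /andP[n1 n2].
(* Close to a nonzero limit an ultrametric absolute value is constant, so the denominators need no
   separate lower bound. *)
have un : abs (u n) = abs a.
  by rewrite -(subrK a (u n)) addrC absD_gt //; apply: hN.
have un0 : u n != 0 by rewrite -abs_gt0 un.
have -> : (u n)^-1 - a^-1 = - (u n - a) / (u n * a) by field; rewrite un0 a0.
by rewrite (absM HK) absN absV (absM HK) un -expr2 ler_pdivrMr ?exprn_gt0 //; apply: hM.
Qed.

(** * Continuous and strictly differentiable sequences *)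

Definition scont (u : nat -> K) := forall e, 0 < e -> exists k, forall x y : nat,
  abs (x%:R - y%:R) <= rad k -> abs (u x - u y) <= e.

(** Uniform strict differentiability, tested on the naturals only. Writing the estimate without a
    quotient covers x = y, and continuity of [u'] is included because the bounds on [u'] rest on
    it. *)
Definition sdiff (u u' : nat -> K) := scont u' /\
  forall e, 0 < e -> exists k, forall x y : nat, abs (x%:R - y%:R) <= rad k ->
    abs (u x - u y - (x%:R - y%:R) * u' x) <= e * abs (x%:R - y%:R).

(** Riemann sums of the Volkenborn integral, the case q = 1 of I_q. *)
Definition vol (u : nat -> K) (N : nat) : K := (\sum_(x < p ^ N) u x) / (p ^ N)%:R.

Lemma abs_modn k x : abs (x%:R - (x %% p ^ k)%:R) <= rad k.
Proof. by rewrite abs_mod modn_mod. Qed.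

Lemma abs_addM k x y : abs ((x + p ^ k * y)%:R - x%:R) <= rad k.
Proof. by rewrite abs_mod addnC mulnC modnMDl. Qed.

Lemma abs_natB_le1 m n : abs (m%:R - n%:R) <= 1.
Proof. by apply: absB_le; apply: abs_nat. Qed.

Lemma scont_bound u : scont u -> exists B, 0 < B /\ forall x, abs (u x) <= B.
Proof.
move=> hu; have [k hk] := hu 1 ltr01.
have S0 : 0 <= \sum_(i < p ^ k) abs (u i) by apply: sumr_ge0 => i _; apply: abs_nneg.
exists (1 + \sum_(i < p ^ k) abs (u i)); split; first lra.
move=> x; rewrite -(subrK (u (x %% p ^ k)%N) (u x)); apply: absD_le.
  by apply: le_trans (hk _ _ (abs_modn _ _)) _; lra.
have h : (x %% p ^ k < p ^ k)%N by rewrite ltn_mod pXn_gt0.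
apply: (@le_trans _ _ (\sum_(i < p ^ k) abs (u i))); last lra.
rewrite (bigD1 (Ordinal h)) //= lerDl.
by apply: sumr_ge0 => i _; apply: abs_nneg.
Qed.

Lemma scontM u v : scont u -> scont v -> scont (fun x => u x * v x).
Proof.
move=> hu hv; have [A [A0 hA]] := scont_bound _ hu; have [B [B0 hB]] := scont_bound _ hv.
move=> e e0; have [k1 h1] := hu (e / B) (divr_gt0 e0 B0).
have [k2 h2] := hv (e / A) (divr_gt0 e0 A0).
exists (maxn k1 k2) => x y hxy.
have -> : u x * v x - u y * v y = u x * (v x - v y) + (u x - u y) * v y by ring.
apply: absD_le.
  apply: le_trans (absM_le _ _ _ _ (hA x) (h2 x y _)) _.
    by apply: le_trans hxy _; apply: rad_le; apply: leq_maxr.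
  by rewrite mulrC divfK // gt_eqF.
apply: le_trans (absM_le _ _ _ _ (h1 x y _) (hB y)) _.
  by apply: le_trans hxy _; apply: rad_le; apply: leq_maxl.
by rewrite divfK // gt_eqF.
Qed.

Lemma scontD u v : scont u -> scont v -> scont (fun x => u x + v x).
Proof.
move=> hu hv e e0; have [k1 h1] := hu e e0; have [k2 h2] := hv e e0.
exists (maxn k1 k2) => x y hxy; rewrite opprD addrACA; apply: absD_le.
  by apply: h1; apply: le_trans hxy _; apply: rad_le; apply: leq_maxl.
by apply: h2; apply: le_trans hxy _; apply: rad_le; apply: leq_maxr.
Qed.

(** Close points are handled by the bound on [u']; for the others the distance exceeds [rad k], and
    a bound on [u] divided by [rad k] is enough. *)
Lemma sdiff_lip u u' : sdiff u u' ->
  exists L, 0 < L /\ forall x y : nat, abs (u x - u y) <= L * abs (x%:R - y%:R).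
Proof.
case=> hc hd; have [B [B0 hB]] := scont_bound _ hc.
have [k hk] := hd 1 ltr01.
have S0 : 0 <= \sum_(i < p ^ k) abs (u i) by apply: sumr_ge0 => i _; apply: abs_nneg.
set S := \sum_(i < p ^ k) abs (u i) in S0.
have near x y : abs (x%:R - y%:R) <= rad k -> abs (u x - u y) <= (B + 1) * abs (x%:R - y%:R).
  move=> h; rewrite -(subrK ((x%:R - y%:R) * u' x) (u x - u y)); apply: absD_le.
    by apply: le_trans (hk _ _ h) _; apply: ler_wpM2r; rewrite ?abs_nneg //; lra.
  rewrite (absM HK) mulrC; apply: ler_wpM2r; first exact: abs_nneg.
  by apply: le_trans (hB x) _; lra.
(* Continuity of [u] is itself deduced from this lemma, so boundedness comes from [near] and the
   finitely many residues mod p^k. *)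
have bd x : abs (u x) <= B + 1 + S.
  rewrite -(subrK (u (x %% p ^ k)%N) (u x)); apply: absD_le.
    apply: le_trans (near _ _ (abs_modn _ _)) _.
    apply: (@le_trans _ _ ((B + 1) * 1)); last by lra.
    by apply: ler_wpM2l; [lra | apply: abs_natB_le1].
  have h : (x %% p ^ k < p ^ k)%N by rewrite ltn_mod pXn_gt0.
  apply: (@le_trans _ _ S); last lra.
  rewrite /S (bigD1 (Ordinal h)) //= lerDl.
  by apply: sumr_ge0 => i _; apply: abs_nneg.
have r0 := rad_gt0 k.
exists ((B + 1 + S) / rad k); split; first by apply: divr_gt0 => //; lra.
move=> x y; case: (leP (abs (x%:R - y%:R)) (rad k)) => h.
  apply: le_trans (near _ _ h) _; apply: ler_wpM2r; first exact: abs_nneg.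
  by rewrite ler_pdivlMr //; have := rad_le1 k; nra.
rewrite mulrAC ler_pdivlMr //.
apply: (@le_trans _ _ ((B + 1 + S) * rad k)); last by apply: ler_wpM2l; lra.
by apply: ler_wpM2r; [lra | apply: absB_le; apply: bd].
Qed.

Lemma sdiff_scont u u' : sdiff u u' -> scont u.
Proof.
move=> /sdiff_lip [L [L0 hL]] e e0.
have [k hk] := rad_small (e / L) (divr_gt0 e0 L0).
exists k => x y h; apply: le_trans (hL x y) _.
rewrite mulrC -ler_pdivlMr //; apply: le_trans h _; exact: hk.
Qed.

Lemma sdiffM u u' v v' : sdiff u u' -> sdiff v v' ->
  sdiff (fun x => u x * v x) (fun x => u' x * v x + u x * v' x).
Proof.
move=> hu hv; have cu := sdiff_scont _ _ hu; have cv := sdiff_scont _ _ hv.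
split; first by apply: scontD; apply: scontM => //; [case: hu | case: hv].
have [A [A0 hA]] := scont_bound _ cu; have [B [B0 hB]] := scont_bound _ cv.
have [A' [A'0 hA']] := scont_bound _ (proj1 hu).
case: hu hv => _ hu [_ hv] e e0.
have [k1 h1] := hu (e / B) (divr_gt0 e0 B0).
have [k2 h2] := hv (e / A) (divr_gt0 e0 A0).
have [k3 h3] := cv (e / A') (divr_gt0 e0 A'0).
exists (maxn k1 (maxn k2 k3)) => x y hxy.
have [q1 q2 q3] : [/\ abs (x%:R - y%:R) <= rad k1, abs (x%:R - y%:R) <= rad k2 &
    abs (x%:R - y%:R) <= rad k3].
  by split; apply: le_trans hxy (rad_le _ _ _); lia.
set d := x%:R - y%:R in hxy q1 q2 q3 *.
have -> : u x * v x - u y * v y - d * (u' x * v x + u x * v' x) =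
  (u x - u y - d * u' x) * v y + (u x * (v x - v y - d * v' x) - d * u' x * (v x - v y)).
  by ring.
have an := abs_nneg d.
apply: absD_le; first apply: le_trans (absM_le _ _ _ _ (h1 x y q1) (hB y)) _.
  by rewrite -/d mulrAC divfK // gt_eqF.
apply: absB_le.
  apply: le_trans (absM_le _ _ _ _ (hA x) (h2 x y q2)) _.
  by rewrite mulrA [A * _]mulrC divfK // gt_eqF.
have hd : abs (d * u' x) <= abs d * A' by apply: absM_le.
apply: le_trans (absM_le _ _ _ _ hd (h3 x y q3)) _.
by rewrite -mulrA [A' * _]mulrC divfK ?gt_eqF // mulrC.
Qed.

(* A function that is nearly constant mod p^k takes nearly the same value p^m
   times on a full residue system mod p^(k+m). *)
Lemma res_sum (B : R) k e : 0 < e -> exists N0, forall N, (N0 <= N)%N -> forall u : nat -> K,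
  (forall x, (x < p ^ N)%N -> abs (u x) <= B) ->
  (forall x y, (x < p ^ N)%N -> (y < p ^ N)%N -> abs (x%:R - y%:R) <= rad k ->
     abs (u x - u y) <= e) ->
  abs (\sum_(x < p ^ N) u x) <= e.
Proof.
move=> e0; have [j hj] : exists j, forall m, (j <= m)%N -> 0 <= B -> rad m * B <= e.
  case: (leP 0 B) => B0; last by exists 0%N => m _; lra.
  have [j hj] := rad_small (e / (B + 1)) ltac:(by apply: divr_gt0; lra).
  exists j => m /hj h _; apply: (@le_trans _ _ (e / (B + 1) * B)); first exact: ler_wpM2r.
  by rewrite mulrAC ler_pdivrMr; [rewrite ler_pM2l //; lra | lra].
exists (k + j)%N => N hN u hB hu.
have B0 : 0 <= B by apply: le_trans (hB 0%N (pXn_gt0 _)); apply: abs_nneg.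
have [m eN] : exists m, N = (k + m)%N by exists (N - k)%N; lia.
have jm : (j <= m)%N by lia.
have pN : (p ^ N = p ^ k * p ^ m)%N by rewrite eN expnD.
have lt (i : 'I_(p ^ k)) (l : 'I_(p ^ m)) : (i + p ^ k * l < p ^ N)%N.
  rewrite pN; have := ltn_ord i; have := ltn_ord l; move: (p ^ k)%N (p ^ m)%N (i : nat) (l : nat).
  by move=> a b c d; nia.
rewrite pN sum_ord_mul; apply: abs_sum_le => [|i _]; first exact: ltW.
have ltk : (i < p ^ N)%N by have := lt i (Ordinal (pXn_gt0 m)); rewrite muln0 addn0.
have -> : \sum_(j0 < p ^ m) u (i + p ^ k * j0)%N =
    \sum_(j0 < p ^ m) (u (i + p ^ k * j0)%N - u i) + (p ^ m)%:R * u i.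
  by rewrite sumrB sumr_const card_ord mulr_natl subrK.
apply: absD_le; first by apply: abs_sum_le => [|l _]; [exact: ltW | apply: hu => //; apply: abs_addM].
apply: le_trans (hj m jm B0); apply: absM_le; rewrite ?abs_pXn //; exact: hB.
Qed.

Lemma scont_res_sum u e : scont u -> 0 < e -> exists N0, forall N, (N0 <= N)%N ->
  abs (\sum_(x < p ^ N) u x) <= e.
Proof.
move=> hu e0; have [B [_ hB]] := scont_bound _ hu; have [k hk] := hu e e0.
have [N0 h] := res_sum B k e e0; exists N0 => N /h; apply => [x _|x y _ _]; first exact: hB.
exact: hk.
Qed.

Lemma sum_pXnS (u : nat -> K) N :
  \sum_(x < p ^ N.+1) u x = \sum_(i < p ^ N) \sum_(j < p) u (i + p ^ N * j)%N.
Proof. by rewrite expnS mulnC sum_ord_mul. Qed.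

(** Volkenborn sums are bounded by p times the Lipschitz constant. From level M to M + 1, the sum
    over each class is p times the value at its representative, up to errors at most L p^-M; the
    factor p shrinks the previous sum by exactly the ratio of the two bounds. The value h 0 = 0
    starts the induction. Only arguments below p^M are tested, since [cyc_deriv] applies this to
    functions of the truncated S - j. *)
Lemma lip_sum (h : nat -> K) (L : R) (M : nat) : 0 <= L -> h 0%N = 0 ->
  (forall x y, (x < p ^ M)%N -> (y < p ^ M)%N -> abs (h x - h y) <= L * abs (x%:R - y%:R)) ->
  abs (\sum_(x < p ^ M) h x) <= p%:R * L * rad M.
Proof.
move=> L0 h0; elim: M => [|M IH] hL.
  by rewrite expn0 big_ord_recl big_ord0 /= h0 addr0 abs0 rad0; have := pR_gt0; nra.
have le : (p ^ M <= p ^ M.+1)%N by rewrite leq_exp2l ?prime_gt1.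
rewrite sum_pXnS.
have -> : \sum_(i < p ^ M) \sum_(j < p) h (i + p ^ M * j)%N =
    \sum_(i < p ^ M) \sum_(j < p) (h (i + p ^ M * j)%N - h i) + p%:R * \sum_(i < p ^ M) h i.
  rewrite mulr_sumr -big_split /=; apply: eq_bigr => i _.
  by rewrite sumrB sumr_const card_ord mulr_natl subrK.
have e1 : p%:R * L * rad M.+1 = L * rad M by rewrite mulrAC radS mulrC.
apply: absD_le; last first.
  rewrite (absM HK) (abs_p HK) e1 ler_pdivrMl ?pR_gt0 // mulrA.
  by apply: IH => x y hx hy; apply: hL; [apply: leq_trans hx le | apply: leq_trans hy le].
have e2 : 0 <= L * rad M by rewrite mulr_ge0 // rad_ge0.
rewrite e1; apply: abs_sum_le => // i _; apply: abs_sum_le => // j _.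
apply: le_trans (hL _ _ _ _) _.
- have := ltn_ord i; have := ltn_ord j; rewrite expnS; move: (p ^ M)%N (i : nat) (j : nat).
  by move=> a b c; nia.
- exact: leq_trans (ltn_ord i) le.
- by apply: ler_wpM2l => //; apply: abs_addM.
Qed.

Lemma abs_divX x N c : abs x <= c * rad N -> abs (x / (p ^ N)%:R) <= c.
Proof. by rewrite (absM HK) absV abs_pXn ler_pdivrMr // rad_gt0. Qed.

(** To first order the difference of consecutive sums is (sum of j < p) / p times the sum of u' over
    the residues mod p^N, and the latter tends to 0. The tolerance e / p pays for dividing by
    p^(N+1) estimates of order p^N. *)
Lemma vol_conv u u' : sdiff u u' -> exists l, conv (vol u) l.
Proof.
case=> hc hd; apply: cauchy_conv => e e0.
have e1 : 0 < e / p%:R by rewrite divr_gt0 // pR_gt0.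
have [N1 h1] := scont_res_sum _ _ hc e1.
have [k hk] := hd _ e1.
exists (maxn N1 k) => N; rewrite geq_max => /andP[n1 n2].
have -> : vol u N.+1 - vol u N =
   (\sum_(i < p ^ N) \sum_(j < p) (u (i + p ^ N * j)%N - u i)) / (p ^ N.+1)%:R.
  rewrite /vol sum_pXnS.
  have -> : \sum_(i < p ^ N) \sum_(j < p) (u (i + p ^ N * j)%N - u i) =
     \sum_(i < p ^ N) \sum_(j < p) u (i + p ^ N * j)%N - p%:R * \sum_(i < p ^ N) u i.
    rewrite mulr_sumr -sumrB; apply: eq_bigr => i _.
    by rewrite sumrB sumr_const card_ord mulr_natl.
  by rewrite expnS natrM; field; rewrite pXn_neq0 natK_neq0 ?p_gt0.
apply: abs_divX.
have -> : e * rad N.+1 = (e / p%:R) * rad N.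
  by rewrite -(radS N); field; rewrite gt_eqF ?pR_gt0.
have -> : \sum_(i < p ^ N) \sum_(j < p) (u (i + p ^ N * j)%N - u i) =
  \sum_(i < p ^ N) \sum_(j < p) (u (i + p ^ N * j)%N - u i - (p ^ N * j)%:R * u' i) +
  (p ^ N)%:R * (\sum_(j < p) j%:R) * \sum_(i < p ^ N) u' i.
  rewrite mulr_sumr -big_split /=; apply: eq_bigr => i _.
  rewrite mulr_sumr mulr_suml -big_split /=; apply: eq_bigr => j _.
  by rewrite natrM subrK.
have r0 := rad_gt0 N; have p0 := pR_gt0.
apply: absD_le.
  apply: abs_sum_le => [|i _]; first by rewrite mulr_ge0 // ltW.
  apply: abs_sum_le => [|j _]; first by rewrite mulr_ge0 // ltW.
  have hij : abs (i%:R - (i + p ^ N * j)%:R) <= rad N by rewrite absBC; apply: abs_addM.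
  have := hk i (i + p ^ N * j)%N (le_trans hij (rad_le _ _ n2)).
  rewrite -absN; set a := abs _ => h.
  have -> : u (i + p ^ N * j)%N - u i - (p ^ N * j)%:R * u' i =
    - (u i - u (i + p ^ N * j)%N - (i%:R - (i + p ^ N * j)%:R) * u' i).
    by rewrite [(_ + _)%:R]natrD; ring.
  apply: le_trans h _; apply: ler_wpM2l => //; exact: ltW.
rewrite mulrC; apply: absM_le; first exact: h1.
rewrite -abs_pXn (absM HK) ler_piMr ?abs_nneg //.
by rewrite -natr_sum abs_nat.
Qed.

(** * Convolutions *)

Definition convol (u v : nat -> K) (n : nat) : K := \sum_(a < n.+1) u a * v (n - a)%N.

(* The convolution on Z/Q, with residues represented by 0, ..., Q - 1. *)
Definition cyc (Q : nat) (F G : nat -> K) (n : nat) : K :=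
  \sum_(a < Q) F a * G ((n + (Q - a)) %% Q)%N.

(** Congruent naturals are joined by steps of length p^N, and ultrametric errors do not add up along
    the way. *)
Lemma scont_step u :
  (forall e, 0 < e -> exists N, forall n, abs (u (n + p ^ N)%N - u n) <= e) -> scont u.
Proof.
move=> h e e0; have [N hN] := h e e0; exists N.
have key j n : abs (u (n + p ^ N * j)%N - u n) <= e.
  elim: j => [|j IH]; first by rewrite muln0 addn0 subrr abs0 ltW.
  by rewrite mulnS addnCA addnC; apply: abs_chain (hN _) IH.
suff wl x y : (y <= x)%N -> abs (x%:R - y%:R) <= rad N -> abs (u x - u y) <= e.
  move=> x y; case: (leqP y x) => [yx|/ltnW xy]; first exact: wl.
  by rewrite absBC [abs (u _ - _)]absBC; apply: wl.
move=> yx; rewrite -natrB // abs_dvd => /dvdnP[j ej].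
by rewrite -(subnKC yx) ej mulnC.
Qed.

(** As b runs over the residues mod p^N, both factors are nearly constant on classes mod p^k, so
    [res_sum] applies. The uniformity in n is what the convolution estimates rely on. *)
Lemma scont_refl_sum u v e : scont u -> scont v -> 0 < e ->
  exists N0, forall N, (N0 <= N)%N -> forall n,
  abs (\sum_(b < p ^ N) u (n + b)%N * v (p ^ N - b.+1)%N) <= e.
Proof.
move=> hu hv e0; have [A [A0 hA]] := scont_bound _ hu.
have [B [B0 hB]] := scont_bound _ hv.
have [k1 h1] := hu (e / B) (divr_gt0 e0 B0); have [k2 h2] := hv (e / A) (divr_gt0 e0 A0).
have [N0 h] := res_sum (A * B) (maxn k1 k2) e e0; exists N0 => N hN n.
apply: (h N hN (fun b => u (n + b)%N * v (p ^ N - b.+1)%N)) => [x _|x y hx hy hxy].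
  exact: absM_le.
have -> : u (n + x)%N * v (p ^ N - x.+1)%N - u (n + y)%N * v (p ^ N - y.+1)%N =
  u (n + x)%N * (v (p ^ N - x.+1)%N - v (p ^ N - y.+1)%N) +
  (u (n + x)%N - u (n + y)%N) * v (p ^ N - y.+1)%N by ring.
apply: absD_le.
  apply: le_trans (absM_le _ _ _ _ (hA _) (h2 _ _ _)) _.
    rewrite !natrB // absBC; apply: le_trans (rad_le _ _ (leq_maxr k1 k2)).
    by rewrite -!natr1 (_ : _ - _ = x%:R - y%:R) //; ring.
  by rewrite mulrC divfK // gt_eqF.
apply: le_trans (absM_le _ _ _ _ (h1 _ _ _) (hB _)) _.
  rewrite (_ : _ - _ = x%:R - y%:R); last by rewrite !natrD; ring.
  by apply: le_trans hxy (rad_le _ _ (leq_maxl k1 k2)).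
by rewrite divfK // gt_eqF.
Qed.

(** The new indices a = n + 1 + b face P - 1 - b, which again runs over all residues mod P; this sum
    is therefore small by [scont_refl_sum]. *)
Lemma convol_add u v n P :
  convol u v (n + P) - convol u v n =
  \sum_(a < n.+1) u a * (v (n - a + P)%N - v (n - a)%N) +
  \sum_(b < P) u (n.+1 + b)%N * v (P - b.+1)%N.
Proof.
rewrite /convol -addSn big_split_ord /= addrAC -sumrB; congr (_ + _).
  by apply: eq_bigr => a _; rewrite -mulrBr; congr (_ * (v _ - _)); have := ltn_ord a; lia.
by apply: eq_bigr => b _; congr (_ * v _); have := ltn_ord b; lia.
Qed.

Lemma convol_scont u v : scont u -> scont v -> scont (convol u v).
Proof.
move=> hu hv; apply: scont_step => e e0.
have [A [A0 hA]] := scont_bound _ hu.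
have [k hk] := hv (e / A) (divr_gt0 e0 A0).
have [N0 h] := scont_refl_sum _ _ _ hu hv e0.
exists (maxn k N0) => n; rewrite convol_add; apply: absD_le; last by apply: h; apply: leq_maxr.
apply: abs_sum_le => [|a _]; first exact: ltW.
apply: le_trans (absM_le _ _ _ _ (hA _) (hk _ _ _)) _.
  rewrite natrD addrAC subrr add0r abs_pXn; apply: rad_le; exact: leq_maxl.
by rewrite mulrC divfK // gt_eqF.
Qed.

(** The summation window {0, ..., Q - 1} for a is moved to {n + 1, ..., n + Q}. There the index of G
    is Q - 1 - x without any reduction mod Q, at the price of the correction F a - F (a + Q) for a
    <= n. *)
Lemma cycE Q F G n : (n < Q)%N ->
  cyc Q F G n = \sum_(a < n.+1) (F a - F (a + Q)%N) * G (n - a)%N +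
                \sum_(x < Q) F (n.+1 + x)%N * G (Q - x.+1)%N.
Proof.
move=> nQ; have [S eQ] : exists S, Q = (n.+1 + S)%N by exists (Q - n.+1)%N; lia.
have sumQ (u : nat -> K) : \sum_(x < Q) u x = \sum_(i < S) u i + \sum_(a < n.+1) u (S + a)%N.
  by rewrite eQ addnC big_split_ord.
have sumQ' (u : nat -> K) : \sum_(x < Q) u x = \sum_(a < n.+1) u a + \sum_(i < S) u (n.+1 + i)%N.
  by rewrite eQ big_split_ord.
rewrite /cyc (sumQ (fun x => F (n.+1 + x)%N * G (Q - x.+1)%N)).
rewrite (sumQ' (fun a => F a * G ((n + (Q - a)) %% Q)%N)) /=.
rewrite [RHS]addrCA [LHS]addrC; congr (_ + _).
  apply: eq_bigr => i _; have := ltn_ord i => hi.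
  by rewrite modn_small; last lia; congr (_ * G _); lia.
rewrite -big_split /=; apply: eq_bigr => a _; have := ltn_ord a => ha.
have -> : (n.+1 + (S + a) = a + Q)%N by lia.
have -> : (Q - (S + a).+1 = n - a)%N by lia.
rewrite -mulrDl subrK; congr (_ * G _).
by rewrite (_ : n + (Q - a) = (n - a) + Q)%N; [rewrite modnDr modn_small //; lia | lia].
Qed.

(* Summation by parts along each residue class mod P; the boundary terms cancel
   against those of the convolution part of cycE. *)
Lemma cyc_diff P S F G n : (n + P < P * S)%N ->
  cyc (P * S) F G (n + P) - cyc (P * S) F G n =
  \sum_(a < n.+1) (F a - F (a + P * S)%N) * (G (n - a + P)%N - G (n - a)%N) +
  \sum_(b < P) \sum_(j < S)
    (F (n.+1 + b + P * (S - j))%N - F (n.+1 + b + P * (S - j.+1))%N) *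
    (G (P - b.+1 + P * j)%N - G (P - b.+1)%N).
Proof.
move=> nP; set Q := (P * S)%N; set D := fun a => F a - F (a + Q)%N.
rewrite !cycE //; last by apply: leq_ltn_trans nP; apply: leq_addr.
rewrite opprD addrACA.
have -> : forall m, \sum_(a < m.+1) (F a - F (a + Q)%N) * G (m - a)%N = convol D G m by [].
rewrite convol_add -addrA; congr (_ + _).
have rev b (j : 'I_S) : (b < P)%N -> (Q - (b + P * (rev_ord j)).+1 = P - b.+1 + P * j)%N.
  move=> hb; have hj := ltn_ord j; rewrite /= /Q; move: (nat_of_ord j) hj => i hi.
  have [t eS] : exists t, S = (t + i + 1)%N by exists (S - i.+1)%N; lia.
  rewrite {1 2}eS (_ : t + i + 1 - i.+1 = t)%N; last lia.
  by rewrite !mulnDr muln1; lia.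
have cE m : \sum_(x < Q) F (m.+1 + x)%N * G (Q - x.+1)%N =
  \sum_(b < P) \sum_(j < S) F (m.+1 + b + P * (S - j.+1))%N * G (P - b.+1 + P * j)%N.
  rewrite (sum_ord_mul _ (fun x => F (m.+1 + x)%N * G (Q - x.+1)%N)).
  apply: eq_bigr => b _; rewrite (reindex_inj rev_ord_inj) /=.
  by apply: eq_bigr => j _; rewrite rev // addnA.
rewrite !cE -sumrB -big_split /=; apply: eq_bigr => b _; rewrite -sumrB.
have hb := ltn_ord b.
have tel : \sum_(j < S) (F (n.+1 + b + P * (S - j))%N - F (n.+1 + b + P * (S - j.+1))%N) =
   - D (n.+1 + b)%N.
  rewrite -(big_mkord predT (fun j => F (n.+1 + b + P * (S - j))%N - F (n.+1 + b + P * (S - j.+1))%N)).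
  rewrite (telescope_sumr_eq (fun j => - F (n.+1 + b + P * (S - j))%N)) // => [|j _].
    by rewrite subnn muln0 addn0 subn0 /D -addnA; ring.
  by rewrite opprK addrC.
have -> : \sum_(j < S) (F (n.+1 + b + P * (S - j))%N - F (n.+1 + b + P * (S - j.+1))%N) *
    (G (P - b.+1 + P * j)%N - G (P - b.+1)%N) =
  \sum_(j < S) (F (n.+1 + b + P * (S - j))%N - F (n.+1 + b + P * (S - j.+1))%N) *
    G (P - b.+1 + P * j)%N -
  \sum_(j < S) (F (n.+1 + b + P * (S - j))%N - F (n.+1 + b + P * (S - j.+1))%N) * G (P - b.+1)%N.
  by rewrite -sumrB; apply: eq_bigr => j _; rewrite mulrBr.
rewrite -mulr_suml tel mulNr opprK addrC; congr (_ + _).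
apply: eq_bigr => j _; rewrite -mulrBl; congr ((F _ - _) * _).
have hj := ltn_ord j.
by rewrite (_ : S - j = (S - j.+1).+1)%N; [rewrite mulnS; lia | lia].
Qed.

(** The slope is taken at the base point s for all i and j: the progression stays within p^-N of s,
    where continuity of [u'] makes the change of base point negligible. *)
Lemma sdiff_aff u u' : sdiff u u' -> forall e, 0 < e -> exists k, forall N, (k <= N)%N ->
  forall s i j : nat, abs (u (s + p ^ N * i)%N - u (s + p ^ N * j)%N -
     (p ^ N)%:R * (i%:R - j%:R) * u' s) <= e * rad N * abs (i%:R - j%:R).
Proof.
move=> [hc hd] e e0; have [k1 h1] := hc e e0; have [k2 h2] := hd e e0.
exists (maxn k1 k2) => N; rewrite geq_max => /andP[n1 n2] s i j.
set x := (s + p ^ N * i)%N; set y := (s + p ^ N * j)%N.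
have exy : x%:R - y%:R = (p ^ N)%:R * (i%:R - j%:R) :> K by rewrite !natrD !natrM; ring.
have axy : abs (x%:R - y%:R) = rad N * abs (i%:R - j%:R) by rewrite exy (absM HK) abs_pXn.
have hxy : abs (x%:R - y%:R) <= rad k2.
  rewrite axy; apply: le_trans (rad_le _ _ n2).
  by rewrite ler_piMr ?rad_ge0 // abs_natB_le1.
rewrite -exy -mulrA -axy.
have -> : u x - u y - (x%:R - y%:R) * u' s =
  (u x - u y - (x%:R - y%:R) * u' x) + (x%:R - y%:R) * (u' x - u' s) by ring.
apply: absD_le; first exact: h2.
rewrite mulrC; apply: absM_le => //; apply: h1.
by apply: le_trans (abs_addM _ _ _) (rad_le _ _ n1).
Qed.

(** The sum is p^m (p^m - 1) / 2; the factor p covers the 2 in the denominator when p = 2. *)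
Lemma abs_sum_id m : abs (\sum_(j < p ^ m) j%:R) <= p%:R * rad m.
Proof.
rewrite -[p%:R]mulr1; apply: (lip_sum (fun j => j%:R)) => // x y _ _.
by rewrite mul1r.
Qed.

Lemma natr_subS (V : pzRingType) j m : (j < m)%N -> (m - j)%:R - (m - j.+1)%:R = 1 :> V.
Proof. by move=> h; rewrite -natrB ?leq_sub2l // (_ : m - j - (m - j.+1) = 1)%N //; lia. Qed.

Lemma natr_sub_sub (V : pzRingType) i j m : (i <= m)%N -> (j <= m)%N ->
  (m - i)%:R - (m - j)%:R = - (i%:R - j%:R) :> V.
Proof. by move=> hi hj; rewrite !natrB // opprB [LHS]addrC addrA subrK opprB. Qed.

(** In [cyc_diff] the increments of the first sum are about - p^M F' and p^N G', which yields - p^M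
    p^N T. In the second sum they are about p^N F' and p^N j G', so its main part is p^(2N) times
    the sum of the j times a small reflected sum. Bounding the remainder term by term would give
    order p^-2N only, whereas p^-(N+M) is required; [lip_sum] in the variable j closes this gap. *)
Lemma cyc_deriv F F' G G' : sdiff F F' -> sdiff G G' -> forall e, 0 < e ->
  exists N0, forall N M n, (N0 <= N)%N -> (N <= M)%N -> (n + p ^ N < p ^ M)%N ->
    abs ((cyc (p ^ M) F G (n + p ^ N) - cyc (p ^ M) F G n) / (p ^ M)%:R
         + (p ^ N)%:R * convol F' G' n) <= e * rad N.
Proof.
move=> hF hG e e0.
have [A [A0 hA]] := scont_bound _ (proj1 hF).
have [L [L0 hL]] := sdiff_lip _ _ hG.
have p0 := pR_gt0; have p1 := pR_gt1.
(* [C] dominates both the Lipschitz constant of G and the bound of F'; [e1] is chosen so that the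
   factor p of [lip_sum] turns C e1 into exactly e. *)
set C := L + A; have C0 : 0 < C by rewrite /C; lra.
have AC : A <= C by rewrite /C; lra.
have LC : L <= C by rewrite /C; lra.
set e1 := e / (p%:R * C); have e10 : 0 < e1 by rewrite divr_gt0 // mulr_gt0.
have e1E : p%:R * (C * e1) = e by rewrite /e1; field; rewrite !gt_eqF.
clearbody e1.
have Ce0 : 0 < C * e1 by rewrite mulr_gt0.
have Ce : C * e1 <= e by nra.
have ep0 : 0 < e / p%:R by rewrite divr_gt0.
have [k1 h1] := sdiff_aff _ _ hF e1 e10; have [k2 h2] := sdiff_aff _ _ hG e1 e10.
have [k3 h3] := scont_refl_sum _ _ _ (proj1 hF) (proj1 hG) ep0.
exists (maxn k1 (maxn k2 k3)) => N M n; rewrite !geq_max => /and3P[n1 n2 n3] NM.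
have [m eM] : exists m, M = (N + m)%N by exists (M - N)%N; rewrite subnKC.
have eQ : (p ^ M = p ^ N * p ^ m)%N by rewrite eM expnD.
have m1 : (k1 <= M)%N by apply: leq_trans NM.
set P := (p ^ N)%N in eQ *; set S := (p ^ m)%N in eQ; set Q := (p ^ M)%N in eQ *.
rewrite {1}eQ => nP; rewrite [in cyc Q]eQ cyc_diff // -eQ.
have rN := rad_gt0 N; have rM := rad_gt0 M; have rm := rad_gt0 m.
have rE : rad M = rad N * rad m by rewrite eM radD.
have aP : abs (P%:R : K) = rad N by rewrite abs_pXn.
have aQ : abs (Q%:R : K) = rad M by rewrite abs_pXn.
have Q0 : Q%:R != 0 :> K by apply: pXn_neq0.
rewrite -[X in abs (_ + X)](mulfK Q0) -mulrDl; apply: abs_divX.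
rewrite addrAC; apply: absD_le.
  rewrite /convol mulr_sumr mulr_suml -big_split /=; apply: abs_sum_le => [|a _].
    by apply: ltW; rewrite !mulr_gt0.
  have := h1 M m1 a 1%N 0%N; rewrite -/Q muln0 addn0 muln1 subr0 mulr1 abs1 mulr1.
  set d := F _ - _ - _ => hd.
  have := h2 N n2 (n - a)%N 1%N 0%N; rewrite -/P muln0 addn0 muln1 subr0 mulr1 abs1 mulr1.
  set d' := G _ - _ - _ => hd'.
  have hdG : abs (G (n - a + P)%N - G (n - a)%N) <= L * rad N.
    by apply: le_trans (hL _ _) _; rewrite natrD addrAC subrr add0r aP.
  have -> : (F a - F (a + Q)%N) * (G (n - a + P)%N - G (n - a)%N)
    + P%:R * (F' a * G' (n - a)%N) * Q%:R =
    - (d * (G (n - a + P)%N - G (n - a)%N) + Q%:R * F' a * d') by rewrite /d /d'; ring.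
  have le1 : C * e1 * rad N * rad M <= e * rad N * rad M.
    by apply: ler_wpM2r; [exact: ltW | apply: ler_wpM2r; first exact: ltW].
  have w0 : 0 <= e1 * rad N * rad M by apply: ltW; rewrite !mulr_gt0.
  have CE : C * e1 * rad N * rad M = C * (e1 * rad N * rad M) by rewrite !mulrA.
  rewrite CE in le1.
  rewrite absN; apply: le_trans le1; apply: absD_le.
    apply: le_trans (absM_le _ _ _ _ hd hdG) _.
    have -> : e1 * rad M * (L * rad N) = L * (e1 * rad N * rad M) by ring.
    exact: ler_wpM2r.
  apply: le_trans (absM_le _ _ _ _ (absM_le _ _ _ _ (lexx _) (hA a)) hd') _.
  rewrite aQ.
  have -> : rad M * A * (e1 * rad N) = A * (e1 * rad N * rad M) by ring.
  exact: ler_wpM2r.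
set FF := fun b => F' (n.+1 + b)%N; set GG := fun b => G' (P - b.+1)%N.
pose dF b j := F (n.+1 + b + P * (S - j))%N - F (n.+1 + b + P * (S - j.+1))%N.
pose dG b j := G (P - b.+1 + P * j)%N - G (P - b.+1)%N.
have -> : \sum_(b < P) \sum_(j < S) dF b j * dG b j =
  \sum_(b < P) \sum_(j < S) (dF b j * dG b j - P%:R ^+ 2 * j%:R * (FF b * GG b)) +
  P%:R ^+ 2 * (\sum_(j < S) j%:R) * \sum_(b < P) FF b * GG b.
  rewrite mulr_sumr -big_split /=; apply: eq_bigr => b _.
  by rewrite sumrB mulr_sumr mulr_suml subrK.
apply: absD_le; last first.
  apply: le_trans (absM_le _ _ _ _ (absM_le _ _ _ _ (lexx _) (abs_sum_id m)) (h3 N n3 n.+1)) _.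
  rewrite absX aP rE le_eqVlt; apply/orP; left; apply/eqP; field.
  by rewrite gt_eqF.
apply: abs_sum_le => [|b _]; first by apply: ltW; rewrite !mulr_gt0.
have Sgt0 : (0 < S)%N by apply: pXn_gt0.
(* At j = 0 the remainder vanishes because [dG b 0] does, as [lip_sum] requires. *)
apply: le_trans (lip_sum (fun j => dF b j * dG b j - P%:R ^+ 2 * j%:R * (FF b * GG b))
  (C * e1 * rad N ^+ 2) m _ _ _) _.
- by rewrite mulr_ge0 ?exprn_ge0 // ltW.
- by rewrite /dG muln0 addn0 subrr !mulr0 mul0r subr0.
- move=> i j hi hj; rewrite -/S in hi hj.
  have dGE x : abs (dG b x) <= L * rad N.
    apply: le_trans (hL _ _) _; rewrite natrD addrAC subrr add0r natrM (absM HK) aP.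
    by rewrite ler_pM2l // ler_piMr ?abs_nat // ltW.
  have dGB : abs (dG b i - dG b j) <= L * (rad N * abs (i%:R - j%:R)).
    rewrite /dG opprB addrA subrK; apply: le_trans (hL _ _) _.
    by rewrite !natrD addrAC opprD addrA subrr add0r addrC !natrM -mulrBr (absM HK) aP.
  have dGD : abs (dG b i - dG b j - P%:R * (i%:R - j%:R) * GG b) <= e1 * rad N * abs (i%:R - j%:R).
    by rewrite /dG opprB addrA subrK; apply: h2.
  have dFD : abs (dF b j - P%:R * FF b) <= e1 * rad N.
    have := h1 N n1 (n.+1 + b)%N (S - j)%N (S - j.+1)%N.
    by rewrite natr_subS // abs1 !mulr1.
  have dFB : abs (dF b i - dF b j) <= e1 * rad N * abs (i%:R - j%:R).
    have ha := h1 N n1 (n.+1 + b)%N (S - i)%N (S - j)%N.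
    have hb := h1 N n1 (n.+1 + b)%N (S - i.+1)%N (S - j.+1)%N.
    have ea : (S - i)%:R - (S - j)%:R = - (i%:R - j%:R) :> K.
      exact: natr_sub_sub (ltnW hi) (ltnW hj).
    have eb : (S - i.+1)%:R - (S - j.+1)%:R = - (i%:R - j%:R) :> K.
      by rewrite natr_sub_sub // -!natr1; congr (- _); ring.
    rewrite ea absN in ha; rewrite eb absN in hb.
    have := absB_le _ _ _ ha hb; rewrite -/P.
    set X := (X in abs X <= _); move=> hX.
    by rewrite (_ : _ - _ = X) // /X /dF; ring.
  (* Each of the three products has one factor small through e1: the variation of [dF], the error of
     [dF], or the error of [dG]. The other factor supplies what is missing from rad N ^ 2 times the
     distance of i and j. *)
  have -> : dF b i * dG b i - P%:R ^+ 2 * i%:R * (FF b * GG b) -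
    (dF b j * dG b j - P%:R ^+ 2 * j%:R * (FF b * GG b)) =
    (dF b i - dF b j) * dG b i + ((dF b j - P%:R * FF b) * (dG b i - dG b j)
     + P%:R * FF b * (dG b i - dG b j - P%:R * (i%:R - j%:R) * GG b)) by ring.
  set r := abs (i%:R - j%:R) in dGB dGD dFB *; have r0 : 0 <= r by apply: abs_nneg.
  have w0 : 0 <= e1 * rad N ^+ 2 * r by rewrite mulr_ge0 // ltW // mulr_gt0 ?exprn_gt0.
  have -> : C * e1 * rad N ^+ 2 * r = C * (e1 * rad N ^+ 2 * r) by rewrite !mulrA.
  apply: absD_le; last apply: absD_le.
  + apply: le_trans (absM_le _ _ _ _ dFB (dGE i)) _.
    have -> : e1 * rad N * r * (L * rad N) = L * (e1 * rad N ^+ 2 * r) by ring.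
    exact: ler_wpM2r.
  + apply: le_trans (absM_le _ _ _ _ dFD dGB) _.
    have -> : e1 * rad N * (L * (rad N * r)) = L * (e1 * rad N ^+ 2 * r) by ring.
    exact: ler_wpM2r.
  + have hPF : abs (P%:R * FF b) <= rad N * A by apply: absM_le; rewrite ?aP //; apply: hA.
    apply: le_trans (absM_le _ _ _ _ hPF dGD) _.
    have -> : rad N * A * (e1 * rad N * r) = A * (e1 * rad N ^+ 2 * r) by ring.
    exact: ler_wpM2r.
by rewrite rE -e1E le_eqVlt; apply/orP; left; apply/eqP; ring.
Qed.

(** * Functions on the p-adic integers *)

Local Notation Zp := (isZp abs).

Lemma Zp_nat n : Zp n%:R.
Proof. by move=> e e0; exists n; rewrite subrr abs0. Qed.

Lemma Zp_approx z N : Zp z -> exists n : nat, abs (z - n%:R) <= rad N.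
Proof. by move=> /(_ _ (rad_gt0 N)) [n hn]; exists n; apply: ltW. Qed.

Lemma ZpD x y : Zp x -> Zp y -> Zp (x + y).
Proof.
move=> hx hy e e0; have [m hm] := hx e e0; have [n hn] := hy e e0.
by exists (m + n)%N; rewrite natrD opprD addrACA; apply: absD_lt.
Qed.

Lemma ZpN x : Zp x -> Zp (- x).
Proof.
move=> hx e e0; have [n hn] := hx e e0; have [N hN] := rad_small (e / 2) ltac:(lra).
(* A natural number congruent to - n mod p^N. *)
exists (p ^ N * n - n)%N; rewrite natrB ?leq_pmull ?pXn_gt0 //.
rewrite (_ : - x - _ = - (x - n%:R) - (p ^ N * n)%:R); last by ring.
apply: absD_lt; first by rewrite absN.
rewrite absN natrM (absM HK) abs_pXn; apply: (@le_lt_trans _ _ (rad N)).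
  by rewrite ler_piMr ?rad_ge0 // abs_nat.
by apply: le_lt_trans (hN N (leqnn N)) _; lra.
Qed.

Lemma ZpB x y : Zp x -> Zp y -> Zp (x - y).
Proof. by move=> hx /ZpN; apply: ZpD. Qed.

Lemma Zp_abs z : Zp z -> abs z <= 1.
Proof.
move=> hz; have [n hn] := Zp_approx z 0 hz.
by rewrite -(subrK n%:R z); apply: absD_le; rewrite ?abs_nat // -rad0.
Qed.

Lemma Zp_closed z : (forall N, exists x, Zp x /\ abs (z - x) <= rad N) -> Zp z.
Proof.
move=> h e e0; have [N hN] := rad_small (e / 2) ltac:(lra).
have [x [/(_ e e0) [n hn] hx]] := h N; exists n; apply: abs_chain_lt hn.
by apply: le_lt_trans hx _; have := hN N (leqnn N); lra.
Qed.

(* Truncation of the p-adic expansion of z. *)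
Definition tr (N : nat) (z : K) : nat :=
  epsilon (inhabits 0%N) (fun n => (n < p ^ N)%N /\ abs (z - n%:R) <= rad N).

Lemma trP N z : Zp z -> (tr N z < p ^ N)%N /\ abs (z - (tr N z)%:R) <= rad N.
Proof.
move=> hz; apply: (epsilon_spec (inhabits 0%N)
  (fun n => (n < p ^ N)%N /\ abs (z - n%:R) <= rad N)).
have [n hn] := Zp_approx z N hz; exists (n %% p ^ N)%N; split.
  by rewrite ltn_mod pXn_gt0.
exact: abs_chain hn (abs_modn N n).
Qed.

Lemma tr_lt N z : Zp z -> (tr N z < p ^ N)%N. Proof. by case/(trP N). Qed.
Lemma abs_tr N z : Zp z -> abs (z - (tr N z)%:R) <= rad N. Proof. by case/(trP N). Qed.

Lemma tr_uniq N z n : Zp z -> (n < p ^ N)%N -> abs (z - n%:R) <= rad N -> tr N z = n.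
Proof.
move=> hz hn hzn; have [h1 h2] := trP N z hz.
have : abs ((tr N z)%:R - n%:R) <= rad N by apply: abs_chain hzn; rewrite absBC.
by rewrite abs_mod !modn_small // => /eqP.
Qed.

Lemma tr_close N x y : Zp x -> Zp y -> abs (x - y) <= rad N -> tr N x = tr N y.
Proof.
move=> hx hy h; apply: tr_uniq (tr_lt N y hy) _ => //.
exact: abs_chain h (abs_tr N y hy).
Qed.

Lemma tr_cvg z : Zp z -> conv (fun N => (tr N z)%:R) z.
Proof.
move=> hz; apply: convI => e e0; have [N hN] := rad_small e e0; exists N => n nN.
by rewrite absBC; apply: le_trans (abs_tr n z hz) (hN n nN).
Qed.

Lemma ball_split N a x : Zp x -> abs (x - a%:R) <= rad N ->
  exists2 j, (j < p)%N & abs (x - (a + p ^ N * j)%:R) <= rad N.+1.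
Proof.
move=> hx h; have [n0 hn0] := Zp_approx x N.+1 hx.
(* The added multiple of p^(N+1) does not disturb the approximation and gives a <= n, so that n - a
   is a natural number. *)
set n := (n0 + p ^ N.+1 * a)%N.
have hn : abs (x - n%:R) <= rad N.+1 by apply: abs_chain hn0 _; rewrite absBC abs_addM.
have an : (a <= n)%N by rewrite /n (leq_trans (leq_pmull _ (pXn_gt0 N.+1))) ?leq_addl.
have : abs (n%:R - a%:R) <= rad N.
  apply: abs_chain h; rewrite absBC; apply: le_trans hn (rad_le _ _ _); exact: leqnSn.
rewrite -natrB // abs_dvd => /dvdnP[m em].
exists (m %% p)%N; first by rewrite ltn_mod p_gt0.
apply: abs_chain hn _.
have -> : n = (a + p ^ N * m)%N by rewrite mulnC -em subnKC.
rewrite abs_mod; apply/eqP; rewrite {1}(divn_eq m p) mulnDr.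
rewrite (_ : a + _ = (m %/ p) * p ^ N.+1 + (a + p ^ N * (m %% p)))%N; first by rewrite modnMDl.
by rewrite expnS addnCA; congr (_ + _)%N; rewrite mulnCA; ring.
Qed.

(** Compactness of Z_p as induction on the tree of balls, [P N a] being a property of the ball a +
    p^N Z_p. If it failed at the root, a failing child could be chosen at every level; the centres
    converge to some z whose truncations are these centres, against the local hypothesis. *)
Lemma Zp_compact (P : nat -> nat -> Prop) :
  (forall z, Zp z -> exists N, P N (tr N z)) ->
  (forall N a, (forall j, (j < p)%N -> P N.+1 (a + p ^ N * j)%N) -> P N a) -> P 0%N 0%N.
Proof.
move=> hloc hind; apply: NNPP => nP.
pose nxt N a := epsilon (inhabits 0%N) (fun j => (j < p)%N /\ ~ P N.+1 (a + p ^ N * j)%N).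
have nxtP N a : ~ P N a -> (nxt N a < p)%N /\ ~ P N.+1 (a + p ^ N * nxt N a)%N.
  move=> h; apply: (epsilon_spec (inhabits 0%N)
    (fun j => (j < p)%N /\ ~ P N.+1 (a + p ^ N * j)%N)).
  apply: NNPP => h2; apply: h; apply: hind => j hj; apply: NNPP => h3.
  by apply: h2; exists j.
pose a := fix a N := if N is m.+1 then (a m + p ^ m * nxt m (a m))%N else 0%N.
have aP N : ~ P N (a N) /\ (a N < p ^ N)%N.
  elim: N => [|N [h1 h2]] //=; have [h3 h4] := nxtP _ _ h1; split=> //.
  rewrite expnS; apply: (@leq_trans (p ^ N + p ^ N * nxt N (a N))); first by rewrite ltn_add2r.
  by rewrite -mulnS mulnC leq_mul2r h3 orbT.
have aD N m : abs ((a (N + m)%N)%:R - (a N)%:R) <= rad N.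
  elim: m => [|m IH]; first by rewrite addn0 subrr abs0 rad_ge0.
  rewrite addnS; apply: abs_chain IH => /=.
  by apply: le_trans (abs_addM _ _ _) (rad_le _ _ _); apply: leq_addr.
have [z hz] : exists z, conv (fun N => (a N)%:R) z.
  apply: cauchy_conv => e e0; have [N hN] := rad_small e e0; exists N => n nN.
  by have := aD n 1%N; rewrite addn1 => h; apply: le_trans h (hN n nN).
have za N : abs (z - (a N)%:R) <= rad N.
  apply: (conv_le_lim _ _ _ _ N hz (rad_gt0 N)) => n nN.
  by rewrite -(subnKC nN); apply: aD.
have Zz : Zp z by apply: Zp_closed => N; exists (a N)%:R; split => //; apply: Zp_nat.
have [N] := hloc z Zz; rewrite (tr_uniq N z (a N)) //; by case: (aP N).
Qed.

Definition ucont (f : K -> K) := forall e, 0 < e -> exists k, forall x y, Zp x -> Zp y ->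
  abs (x - y) <= rad k -> abs (f x - f y) <= e.

Definition udiff (f f' : K -> K) := ucont f' /\
  forall e, 0 < e -> exists k, forall x y, Zp x -> Zp y -> abs (x - y) <= rad k ->
    abs (f x - f y - (x - y) * f' x) <= e * abs (x - y).

(** Since Z_p has no isolated points, a point y = x + p^N gives a quotient close to both l and l'.
    With l a derivative at x this is uniqueness; with l the derivative at a nearby point it is
    continuity of the derivative. *)
Lemma UD_at_near f x l l' e d : Zp x -> UD_at abs f x l' -> 0 < d -> 0 < e ->
  (forall y, Zp y -> x != y -> abs (y - x) < d -> abs ((f x - f y) / (x - y) - l) <= e) ->
  abs (l' - l) <= e.
Proof.
move=> hx hl' d0 e0 h; have [d' [d'0 hd']] := hl' e e0.
have mm : 0 < Num.min d d' by rewrite lt_min d0.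
have m0 : 0 < Num.min d d' / 2 by rewrite divr_gt0.
have [N hN] := rad_small _ m0.
have hlt : rad N < Num.min d d'.
  by apply: le_lt_trans (hN N (leqnn N)) _; move: (Num.min d d') mm => u; lra.
set y := x + (p ^ N)%:R.
have hy : Zp y by apply: ZpD => //; apply: Zp_nat.
have xy : x != y by rewrite /y -[X in X != _]addr0 (inj_eq (addrI x)) eq_sym pXn_neq0.
have dy : abs (y - x) = rad N by rewrite /y addrAC subrr add0r abs_pXn.
move: hlt; rewrite lt_min => /andP[q1 q2].
have h1 : abs ((f x - f y) / (x - y) - l') <= e.
  by apply/ltW/hd' => //; rewrite ?dy // subrr abs0.
apply: (abs_chain ((f x - f y) / (x - y))); first by rewrite absBC.
by apply: h => //; rewrite dy.
Qed.

Lemma UD_at_uniq f x l l' : Zp x -> UD_at abs f x l -> UD_at abs f x l' -> l = l'.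
Proof.
move=> hx h h'; apply/eqP; rewrite eq_sym -subr_eq0; apply/eqP/abs_le0 => e e0.
have [d [d0 hd]] := h e e0.
apply: (UD_at_near f x l l' e d) => // y hy xy yd; apply/ltW/hd => //.
by rewrite subrr abs0.
Qed.

Lemma derivK_eq f x l : Zp x -> UD_at abs f x l -> derivK abs f x = l.
Proof.
move=> hx h; apply: (UD_at_uniq f x) => //.
by apply: (epsilon_spec (inhabits 0) (fun l => UD_at abs f x l)); exists l.
Qed.

Lemma UD_derivK f x : UD abs f -> Zp x -> UD_at abs f x (derivK abs f x).
Proof.
move=> h hx; apply: (epsilon_spec (inhabits 0) (fun l => UD_at abs f x l)); exact: h.
Qed.

Lemma bounded_choice (Q : nat -> nat -> Prop) m :
  (forall j k k', (k <= k')%N -> Q j k -> Q j k') ->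
  (forall j, (j < m)%N -> exists k, Q j k) -> exists k, forall j, (j < m)%N -> Q j k.
Proof.
move=> mono; elim: m => [|m IH] h; first by exists 0%N.
have [k1 h1] := IH (fun j hj => h j (ltnW hj)).
have [k2 h2] := h m (ltnSn m).
exists (maxn k1 k2) => j; rewrite ltnS leq_eqVlt => /predU1P[->|hj].
  by apply: mono h2; apply: leq_maxr.
by apply: mono (h1 j hj); apply: leq_maxl.
Qed.

(** [UD] is a pointwise condition. Around each z all quotients, hence all derivatives, are within e
    of the derivative at z, and [Zp_compact] makes the radius uniform. Both estimates are proved
    together so that one compactness argument serves them. *)
Lemma UD_udiff f : UD abs f -> udiff f (derivK abs f).
Proof.
move=> hf; suff key e : 0 < e -> exists k, forall x y, Zp x -> Zp y -> abs (x - y) <= rad k ->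
    abs (derivK abs f x - derivK abs f y) <= e /\
    abs (f x - f y - (x - y) * derivK abs f x) <= e * abs (x - y).
  by split=> e /key [k hk]; exists k => x y hx hy /(hk x y hx hy) [].
move=> e0; pose P N a := exists k, forall x y, Zp x -> Zp y -> abs (x - a%:R) <= rad N ->
  abs (x - y) <= rad k -> abs (derivK abs f x - derivK abs f y) <= e /\
    abs (f x - f y - (x - y) * derivK abs f x) <= e * abs (x - y).
have [||k hk] := Zp_compact P.
- move=> z hz; have [d [d0 hd]] := UD_derivK f z hf hz e e0.
  have [N hN] := rad_small (d / 2) ltac:(lra); have rN := hN N (leqnn N).
  exists N, N => x y hx hy hxz hxy.
  have bx u : abs (u - (tr N z)%:R) <= rad N -> abs (u - z) < d.
    move=> h; apply: (@le_lt_trans _ _ (rad N)); last by lra.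
    by apply: abs_chain h _; rewrite absBC abs_tr.
  have dx := bx _ hxz.
  have dy : abs (y - z) < d by apply: bx; apply: abs_chain hxz; rewrite absBC.
  have dd u : Zp u -> abs (u - z) < d -> abs (derivK abs f u - derivK abs f z) <= e.
    move=> hu hud; apply: (UD_at_near f u _ _ e d) => //; first exact: UD_derivK.
    move=> v hv uv vd; apply/ltW/hd => //; exact: abs_chain_lt vd hud.
  split; first by apply: abs_chain (dd _ hx dx) _; rewrite absBC; apply: dd.
  have [->|nxy] := eqVneq x y; first by rewrite !subrr mul0r subrr abs0 mulr0.
  have nz : x - y != 0 by rewrite subr_eq0.
  have -> : f x - f y - (x - y) * derivK abs f x =
    (x - y) * (((f x - f y) / (x - y) - derivK abs f z) -
               (derivK abs f x - derivK abs f z)) by field.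
  rewrite mulrC; apply: absM_le => //; apply: absB_le; last exact: dd.
  by apply/ltW/hd.
- move=> N a h.
  have [k hk] := bounded_choice (fun j k => forall x y, Zp x -> Zp y ->
     abs (x - (a + p ^ N * j)%:R) <= rad N.+1 -> abs (x - y) <= rad k ->
     abs (derivK abs f x - derivK abs f y) <= e /\
     abs (f x - f y - (x - y) * derivK abs f x) <= e * abs (x - y)) p
     (fun j k k' kk' H x y hx hy h1 h2 => H x y hx hy h1 (le_trans h2 (rad_le _ _ kk'))) h.
  exists k => x y hx hy hxa hxy; have [j jp hj] := ball_split N a x hx hxa.
  exact: hk hj hxy.
exists k => x y hx hy hxy; apply: hk => //; rewrite subr0 rad0; exact: Zp_abs.
Qed.

Lemma udiff_comp f f' (s : nat -> K) c : udiff f f' -> (forall x, Zp (s x)) -> abs c <= 1 ->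
  (forall x y, s x - s y = c * (x%:R - y%:R)) ->
  sdiff (fun x => f (s x)) (fun x => c * f' (s x)).
Proof.
move=> [h1 h2] hs c1 hc.
have sle x y : abs (s x - s y) <= abs (x%:R - y%:R).
  by rewrite hc (absM HK) ler_piMl ?abs_nneg.
split=> e e0.
  have [k hk] := h1 e e0; exists k => x y hxy; rewrite -mulrBr -[e]mul1r.
  by apply: absM_le => //; apply: hk => //; apply: le_trans hxy.
have [k hk] := h2 e e0; exists k => x y hxy.
have -> : (x%:R - y%:R) * (c * f' (s x)) = (s x - s y) * f' (s x) by rewrite hc; ring.
apply: le_trans (hk _ _ (hs x) (hs y) (le_trans (sle x y) hxy)) _.
by apply: ler_wpM2l => //; apply: ltW.
Qed.

Lemma udiff_nat f f' : udiff f f' -> sdiff (fun x => f x%:R) (fun x => f' x%:R).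
Proof.
move=> h; have := udiff_comp f f' (fun x => x%:R) 1 h Zp_nat.
rewrite abs1 => /(_ (lexx _) (fun x y => esym (mul1r _))) [h1 h2].
by split=> e e0; [have [k hk] := h1 e e0 | have [k hk] := h2 e e0]; exists k => x y /hk;
  rewrite !mul1r.
Qed.

(** For [scont u] this is the continuous extension of u to Z_p; by [ext_close] the convergence is
    uniform in z. *)
Definition ext (u : nat -> K) (z : K) : K := lim_seq abs (fun N => u (tr N z)).

Lemma ext_close u e : scont u -> 0 < e -> exists k, forall N z, (k <= N)%N -> Zp z ->
  abs (u (tr N z) - ext u z) <= e.
Proof.
move=> hu e0.
have cv z : Zp z -> conv (fun N => u (tr N z)) (ext u z).
  move=> hz; apply: lim_conv; apply: cauchy_conv => d d0.
  have [k hk] := hu d d0; exists k => n kn; apply: hk.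
  apply: (abs_chain z); last by apply: le_trans (abs_tr n z hz) (rad_le _ _ kn).
  by rewrite absBC; apply: le_trans (abs_tr _ z hz) (rad_le _ _ (leqW kn)).
have [k hk] := hu e e0; exists k => N z kN hz; rewrite absBC.
apply: (conv_le_lim _ _ _ _ N (cv z hz) e0) => n nN; apply: hk.
apply: (abs_chain z); last by apply: le_trans (abs_tr N z hz) (rad_le _ _ kN).
by rewrite absBC; apply: le_trans (abs_tr n z hz) (rad_le _ _ (leq_trans kN nN)).
Qed.

Lemma ext_conv u z : scont u -> Zp z -> conv (fun N => u (tr N z)) (ext u z).
Proof.
by move=> hu hz; apply: convI => e e0; have [k hk] := ext_close u e hu e0; exists k => N hN; apply: hk.
Qed.

(** Replaces a distance by a power of p at the cost of a factor p; this is why the tolerance e1 with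
    e1 p < e appears in the two differentiability proofs that use it. *)
Lemma abs_level k x : x != 0 -> abs x <= rad k ->
  exists N, [/\ (k <= N)%N, abs x <= rad N & rad N <= p%:R * abs x].
Proof.
rewrite -abs_gt0 => x0 hk; have [M hM] := rad_small (abs x / 2) ltac:(lra).
have ex : exists n, ~~ (abs x <= rad n).
  by exists M; rewrite -ltNge; have := hM M (leqnn M); lra.
case: (ex_minnP ex) => m hm mmin.
have km : (k < m)%N.
  by rewrite ltnNge; apply: contra hm => mk; apply: le_trans hk (rad_le _ _ mk).
case: m hm mmin km => // N hN mmin kN; exists N; split => //.
  by apply/negPn/negP => /mmin; rewrite ltnn.
by rewrite -radS ler_pM2l ?pR_gt0 //; apply: ltW; rewrite ltNge.
Qed.

(** At stage M, truncations that agree mod p^N are joined by steps p^N whose errors do not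
    accumulate, and T is nearly constant around z. As the estimate is uniform in M, it passes to the
    limit for fixed x and y. *)
Lemma UD_at_lim (w : nat -> nat -> K) (H : K -> K) (T : nat -> K) :
  (forall z, Zp z -> conv (fun M => w M (tr M z)) (H z)) -> scont T ->
  (forall e, 0 < e -> exists N0, forall N M n, (N0 <= N)%N -> (N <= M)%N ->
     (n + p ^ N < p ^ M)%N ->
     abs (w M (n + p ^ N)%N - w M n + (p ^ N)%:R * T n) <= e * rad N) ->
  forall z, Zp z -> UD_at abs H z (- ext T z).
Proof.
move=> hw hT hdiff z hz e e0.
have p0 := pR_gt0.
have [e1 [e10 e1E]] : exists e1, 0 < e1 /\ e1 * p%:R < e.
  by exists (e / 2 / p%:R); rewrite divfK ?gt_eqF // !divr_gt0 //; split=> //; lra.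
have [N0 h0] := hdiff e1 e10; have [k1 h1] := hT e1 e10.
have [k2 h2] := ext_close T e1 hT e10.
set k := maxn N0 (maxn k1 k2); exists (rad k); split; first exact: rad_gt0.
have [kN0 kk1 kk2] : [/\ (N0 <= k)%N, (k1 <= k)%N & (k2 <= k)%N].
  by rewrite /k !leq_max !leqnn !orbT.
clearbody k.
have step N M : (k <= N)%N -> (N <= M)%N -> forall j n, abs (z - n%:R) <= rad k ->
  (n + p ^ N * j < p ^ M)%N ->
  abs (w M (n + p ^ N * j)%N - w M n + (p ^ N * j)%:R * ext T z) <= e1 * rad N.
  move=> kN NM; elim=> [|j IH] n hn hlt.
    by rewrite muln0 addn0 subrr add0r mul0r abs0 mulr_ge0 ?rad_ge0 // ltW.
  have hlt' : (n + p ^ N * j < p ^ M)%N.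
    by apply: leq_ltn_trans hlt; rewrite leq_add2l leq_mul2l leqnSn orbT.
  have -> : (n + p ^ N * j.+1 = (n + p ^ N * j) + p ^ N)%N by rewrite mulnS; ring.
  have zn' : abs (z - (n + p ^ N * j)%:R) <= rad k.
    by apply: abs_chain hn _; rewrite absBC; apply: le_trans (abs_addM _ _ _) (rad_le _ _ kN).
  move: zn' (IH n hn hlt') hlt; rewrite mulnSr addnA.
  set m := (n + p ^ N * j)%N => zn' ih hlt.
  have := h0 N M m (leq_trans kN0 kN) NM hlt => hs.
  have tz : abs (T m - ext T z) <= e1.
    apply: (abs_chain (T (tr k z))); last exact: h2.
    apply: h1; apply: (abs_chain z); first by rewrite absBC; apply: le_trans zn' (rad_le _ _ kk1).
    by apply: le_trans (abs_tr k z hz) (rad_le _ _ kk1).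
  have -> : w M (m + p ^ N)%N - w M n + (p ^ N * j + p ^ N)%:R * ext T z =
    (w M (m + p ^ N)%N - w M m + (p ^ N)%:R * T m) +
    ((w M m - w M n + (p ^ N * j)%:R * ext T z) - (p ^ N)%:R * (T m - ext T z)).
    by rewrite [(_ + p ^ N)%:R]natrD; ring.
  apply: absD_le => //; apply: absB_le => //; rewrite mulrC; apply: absM_le => //.
  by rewrite abs_pXn.
have main N M x y : (k <= N)%N -> (N <= M)%N -> Zp x -> Zp y -> abs (x - z) <= rad k ->
   abs (y - z) <= rad k -> abs (x - y) <= rad N ->
   abs (w M (tr M x) - w M (tr M y) + ((tr M x)%:R - (tr M y)%:R) * ext T z) <= e1 * rad N.
  move=> kN NM; wlog le : x y / (tr M y <= tr M x)%N.
    move=> wl hx hy hxz hyz hxy; case: (leqP (tr M y) (tr M x)) => [/wl|/ltnW/wl]; first exact.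
    move=> /(_ hy hx hyz hxz); rewrite absBC => /(_ hxy).
    by rewrite -absN; congr (abs _ <= _); ring.
  move=> hx hy hxz hyz hxy.
  have kM := leq_trans kN NM.
  have : abs ((tr M x)%:R - (tr M y)%:R) <= rad N.
    apply: (abs_chain x); first by rewrite absBC; apply: le_trans (abs_tr M x hx) (rad_le _ _ NM).
    by apply: abs_chain hxy _; apply: le_trans (abs_tr M y hy) (rad_le _ _ NM).
  rewrite -natrB // abs_dvd => /dvdnP[j ej].
  have ex : tr M x = (tr M y + p ^ N * j)%N by rewrite mulnC -ej subnKC.
  rewrite ej [(j * _)%N]mulnC ex; apply: step => //; last by rewrite -ex tr_lt.
  rewrite absBC in hyz; apply: abs_chain hyz _.
  by apply: le_trans (abs_tr M y hy) (rad_le _ _ kM).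
move=> x y hx hy xy hxz hyz.
have xyk : abs (x - y) <= rad k by apply: (abs_chain z); [exact: ltW | rewrite absBC; apply: ltW].
have nz : x - y != 0 by rewrite subr_eq0.
have [N [kN xN pN]] := abs_level k (x - y) nz xyk.
have rN := rad_gt0 N.
have e20 : 0 < e1 * rad N by rewrite mulr_gt0.
have [M1 hM1] := conv_le _ _ _ (hw x hx) e20.
have [M2 hM2] := conv_le _ _ _ (hw y hy) e20.
have c0 := abs_nneg (ext T z).
have [M3 hM3] := rad_small (e1 * rad N / (abs (ext T z) + 1)) ltac:(by apply: divr_gt0 => //; lra).
(* M is chosen after x and y: stage M must approximate H at both points, and both points themselves,
   to within the precision already reached at level N. *)
pose M := maxn N (maxn M1 (maxn M2 M3)).
have [MN MM1 MM2 MM3] : [/\ (N <= M)%N, (M1 <= M)%N, (M2 <= M)%N & (M3 <= M)%N].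
  by rewrite /M !leq_max !leqnn !orbT.
clearbody M.
have bound : abs (H x - H y + (x - y) * ext T z) <= e1 * rad N.
  have -> : H x - H y + (x - y) * ext T z =
    (w M (tr M x) - w M (tr M y) + ((tr M x)%:R - (tr M y)%:R) * ext T z)
    + ((w M (tr M y) - H y) - (w M (tr M x) - H x) +
       ((x - (tr M x)%:R) - (y - (tr M y)%:R)) * ext T z) by ring.
  apply: absD_le; first by apply: main => //; rewrite ltW.
  apply: absD_le; first by apply: absB_le; [apply: hM2 | apply: hM1].
  have hr := hM3 M MM3.
  apply: (@le_trans _ _ (rad M * abs (ext T z))).
    by apply: absM_le => //; apply: absB_le; apply: abs_tr.
  apply: (@le_trans _ _ (e1 * rad N / (abs (ext T z) + 1) * abs (ext T z))).
    exact: ler_wpM2r.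
  by rewrite mulrAC ler_pdivrMr; [rewrite ler_pM2l //; lra | lra].
have -> : (H x - H y) / (x - y) - - ext T z = (H x - H y + (x - y) * ext T z) / (x - y) by field.
have a0 : 0 < abs (x - y) by rewrite abs_gt0.
rewrite (absM HK) absV ltr_pdivrMr //; apply: le_lt_trans bound _.
by apply: (@le_lt_trans _ _ (e1 * (p%:R * abs (x - y)))); rewrite ?ler_pM2l // mulrA ltr_pM2r.
Qed.

Lemma convI0 (u : nat -> K) :
  (forall e, 0 < e -> exists N, forall n, (N <= n)%N -> abs (u n) <= e) -> conv u 0.
Proof. by move=> h; apply: convI => e /h [N hN]; exists N => n /hN; rewrite subr0. Qed.

(** * Limit and perturbation of cyclic convolutions *)

Lemma reflP f f' z : udiff f f' -> Zp z ->
  sdiff (fun x => f (z - x%:R)) (fun x => -1 * f' (z - x%:R)).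
Proof.
move=> hf hz; apply: (udiff_comp f f' (fun x => z - x%:R)) => // [x||x y].
- by apply: ZpB => //; apply: Zp_nat.
- by rewrite absN abs1.
- by ring.
Qed.

Lemma scont_refl f z : ucont f -> Zp z -> scont (fun x => f (z - x%:R)).
Proof.
move=> hf hz e e0; have [k hk] := hf e e0; exists k => x y hxy; apply: hk.
- by apply: ZpB => //; apply: Zp_nat.
- by apply: ZpB => //; apply: Zp_nat.
by rewrite (_ : _ - _ = y%:R - x%:R); [rewrite absBC | ring].
Qed.

Lemma cyc_index Q n a : (n < Q)%N -> (a < Q)%N ->
  ((n + (Q - a)) %% Q = if a <= n then n - a else n + (Q - a))%N.
Proof.
move=> hn ha; case: leqP => an; last by rewrite modn_small //; lia.
rewrite (_ : n + (Q - a) = n - a + Q)%N; last by lia.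
by rewrite modnDr modn_small //; lia.
Qed.

Lemma cyc_vol f f' g g' z : udiff f f' -> udiff g g' -> Zp z ->
  conv (fun N => cyc (p ^ N) (fun x => f x%:R) (fun x => g x%:R) (tr N z) / (p ^ N)%:R
     - vol (fun x => f x%:R * g (z - x%:R)) N
     + convol (fun x => f x%:R) (fun x => g' x%:R) (tr N z)) 0.
Proof.
move=> hf hg hz; apply: convI0 => e e0.
have sf := udiff_nat _ _ hf; have cf := sdiff_scont _ _ sf.
have [A [A0 hA]] := scont_bound _ cf.
have cg' := scont_refl g' z (proj1 hg) hz.
have [N1 hN1] := scont_res_sum _ _ (scontM _ _ cf cg') e0.
have [k1 hk1] := proj1 hg (e / A) (divr_gt0 e0 A0).
have [k2 hk2] := proj2 hg (e / A) (divr_gt0 e0 A0).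
exists (maxn N1 (maxn k1 k2)) => N; rewrite !geq_max => /and3P[n1 n2 n3].
set n := tr N z; have hn : (n < p ^ N)%N by apply: tr_lt.
have zn : abs (n%:R - z) <= rad N by rewrite absBC; apply: abs_tr.
have [Zn Zx] : Zp n%:R /\ forall x : nat, Zp (z - x%:R).
  by split=> [|x]; [apply: Zp_nat | apply: ZpB => //; apply: Zp_nat].
have P0 : (p ^ N)%:R != 0 :> K by apply: pXn_neq0.
have rN := rad_gt0 N.
rewrite -[X in abs (_ + X)](mulfK P0) /vol -mulrBl -mulrDl; apply: abs_divX.
have -> : convol (fun x => f x%:R) (fun x => g' x%:R) n =
  \sum_(a < p ^ N) if (a <= n)%N then f a%:R * g' (n - a)%:R else 0.
  rewrite /convol (big_ord_widen _ (fun a : nat => f a%:R * g' (n - a)%:R) hn) big_mkcond /=.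
  by apply: eq_bigr => a _; rewrite ltnS.
set b := fun a => ((n + (p ^ N - a)) %% p ^ N)%N.
(* Displacement of the index from z - a: n - z comes from truncating z, and p^N from the wrap-around
   when a > n. *)
pose d a : K := (n%:R - z) + (if (a <= n)%N then 0 else (p ^ N)%:R).
have bE (a : nat) : (a < p ^ N)%N -> (b a)%:R - (z - a%:R) = d a.
  move=> ha; rewrite /b /d cyc_index //; case: leqP => an.
    by rewrite natrB //; ring.
  by rewrite natrD natrB ?(ltnW ha) //; ring.
have dle a : abs (d a) <= rad N.
  by apply: absD_le => //; case: ifP => _; rewrite ?abs_pXn // abs0 ltW.
rewrite mulr_suml -sumrB -big_split /=.
(* The wrap-around over a > n is written as all a minus a <= n. The full sum of f(a) g'(z - a) is
   small; the part a <= n cancels the [convol] term up to g'(n - a) - g'(z - a). *)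
have -> : \sum_(a < p ^ N) (f a%:R * g (b a)%:R - f a%:R * g (z - a%:R) +
     (if (a <= n)%N then f a%:R * g' (n - a)%:R else 0) * (p ^ N)%:R) =
   \sum_(a < p ^ N) (f a%:R * (g (b a)%:R - g (z - a%:R) - d a * g' (z - a%:R)) +
     (if (a <= n)%N then f a%:R * (g' (n - a)%:R - g' (z - a%:R)) else 0) * (p ^ N)%:R) +
   (n%:R - z + (p ^ N)%:R) * \sum_(a < p ^ N) f a%:R * g' (z - a%:R).
  rewrite mulr_sumr -big_split /=; apply: eq_bigr => a _; rewrite /d.
  by case: ifP => _; ring.
apply: absD_le; last first.
  by rewrite mulrC; apply: absM_le; [exact: hN1 | apply: absD_le => //; rewrite abs_pXn].
have AE x : abs x <= e / A * rad N -> forall a : nat, abs (f a%:R * x) <= e * rad N.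
  move=> hx a; apply: le_trans (absM_le _ _ _ _ (hA a) hx) _.
  by rewrite mulrA [A * _]mulrC divfK // gt_eqF.
apply: abs_sum_le => [|a _]; first by apply: ltW; rewrite mulr_gt0.
have ha := ltn_ord a; apply: absD_le.
  apply: AE; have := hk2 (z - a%:R) (b a)%:R (Zx a) (Zp_nat _).
  rewrite -absN opprB bE // => /(_ (le_trans (dle a) (rad_le _ _ n3))).
  rewrite -absN => h; apply: le_trans (le_trans h (ler_wpM2l _ (dle a))); last first.
    by apply: ltW; rewrite divr_gt0.
  by rewrite le_eqVlt -bE //; apply/orP; left; apply/eqP; congr abs; ring.
case: ifP => an; last by rewrite mul0r abs0; apply: ltW; rewrite mulr_gt0.
rewrite -mulrA; apply: AE; apply: absM_le; last by rewrite abs_pXn.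
apply: hk1 => //; first exact: Zp_nat.
rewrite natrB // (_ : _ - _ = n%:R - z); first exact: le_trans zn (rad_le _ _ n2).
by ring.
Qed.

Lemma cyc_conv f f' g g' z : udiff f f' -> udiff g g' -> Zp z ->
  exists2 V, conv (vol (fun x => f x%:R * g (z - x%:R))) V &
    conv (fun N => cyc (p ^ N) (fun x => f x%:R) (fun x => g x%:R) (tr N z) / (p ^ N)%:R)
      (V - ext (convol (fun x => f x%:R) (fun x => g' x%:R)) z).
Proof.
move=> hf hg hz; have sf := udiff_nat _ _ hf.
have [V hV] := vol_conv _ _ (sdiffM _ _ _ _ sf (reflP _ _ _ hg hz)).
exists V => //.
have hT := ext_conv _ z (convol_scont _ _ (sdiff_scont _ _ sf) (proj1 (udiff_nat _ _ hg))) hz.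
have := convB _ _ _ _ (convD _ _ _ _ (cyc_vol _ _ _ _ _ hf hg hz) hV) hT.
by rewrite add0r; apply: (conv_eq _ _ _ 0%N) => N _; ring.
Qed.

(** Reduction mod p^N is invisible to v at precision k2 <= N, so the summand is nearly constant on
    residue classes and [res_sum] applies. *)
Lemma cyc_small u v e : scont u -> scont v -> 0 < e -> exists N0, forall N, (N0 <= N)%N ->
  forall n, abs (cyc (p ^ N) u v n) <= e.
Proof.
move=> hu hv e0; have [A [A0 hA]] := scont_bound _ hu.
have [B [B0 hB]] := scont_bound _ hv.
have [k1 h1] := hu (e / B) (divr_gt0 e0 B0); have [k2 h2] := hv (e / A) (divr_gt0 e0 A0).
have [N0 h] := res_sum (A * B) (maxn k1 k2) e e0.
exists (maxn N0 k2) => N; rewrite geq_max => /andP[hN kN] n.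
apply: (h N hN (fun a => u a * v ((n + (p ^ N - a)) %% p ^ N)%N)) => [x _|x y hx hy hxy].
  exact: absM_le.
set bx := (_ %% _)%N; set b := ((n + (p ^ N - y)) %% _)%N.
have -> : u x * v bx - u y * v b = u x * (v bx - v b) + (u x - u y) * v b by ring.
apply: absD_le.
  apply: le_trans (absM_le _ _ _ _ (hA _) (h2 _ _ _)) _; last by rewrite mulrC divfK // gt_eqF.
  have bb a : abs (((n + (p ^ N - a)) %% p ^ N)%:R - (n + (p ^ N - a))%:R) <= rad k2.
    by rewrite absBC; apply: le_trans (abs_modn _ _) (rad_le _ _ kN).
  apply: abs_chain (bb x) _; rewrite absBC; apply: abs_chain (bb y) _.
  rewrite !natrD !natrB 1?ltnW // (_ : _ - _ = x%:R - y%:R); last by ring.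
  exact: le_trans hxy (rad_le _ _ (leq_maxr _ _)).
apply: le_trans (absM_le _ _ _ _ (h1 _ _ _) (hB _)) _; last by rewrite divfK // gt_eqF.
exact: le_trans hxy (rad_le _ _ (leq_maxl _ _)).
Qed.

(** The perturbation is of exact order p^N, so termwise bounds do not give e p^-N. Its first-order
    part is p^N s times cyclic convolutions of continuous functions, small by [cyc_small]; e / p^2
    leaves room for the square of s. *)
Lemma cyc_perturb f f' g g' (s : K) e : scont f -> scont f' -> scont g -> scont g' ->
  abs s <= p%:R -> 0 < e -> exists e2, 0 < e2 /\ exists N0, forall N A B n, (N0 <= N)%N ->
  (forall a, abs (A a - f a - (p ^ N)%:R * s * f' a) <= e2 * rad N) ->
  (forall a, abs (B a - g a - (p ^ N)%:R * s * g' a) <= e2 * rad N) ->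
  abs (cyc (p ^ N) A B n - cyc (p ^ N) f g n) <= e * rad N.
Proof.
move=> cf cf' cg cg' hs e0.
have p0 := pR_gt0; have p1 := pR_gt1.
have [C1 [C10 h1]] := scont_bound _ cf; have [C2 [C20 h2]] := scont_bound _ cf'.
have [C3 [C30 h3]] := scont_bound _ cg; have [C4 [C40 h4]] := scont_bound _ cg'.
set C := p%:R * (C1 + C2 + C3 + C4).
have C0 : 0 < C by rewrite mulr_gt0 //; lra.
have Cge x y : 0 <= x -> 0 <= y -> x <= p%:R -> y <= C1 + C2 + C3 + C4 -> x * y <= C.
  by move=> x0 y0 hx hy; apply: ler_pM.
have Cge1 y : 0 <= y -> y <= C1 + C2 + C3 + C4 -> y <= C.
  by move=> y0 hy; rewrite -[y]mul1r; apply: Cge => //; lra.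
have ep : 0 < e / p%:R ^+ 2 by rewrite divr_gt0 // exprn_gt0.
have [N1 hN1] := cyc_small _ _ _ cf' cg ep.
have [N2 hN2] := cyc_small _ _ _ cf cg' ep.
have [N3 hN3] := cyc_small _ _ _ cf' cg' ep.
(* The condition e2 <= C keeps B bounded by C, and e2 C <= e absorbs the remainders. *)
have [e2 [e20 e2C eC]] : exists e2, [/\ 0 < e2, e2 <= C & e2 * C <= e].
  exists (Num.min C (e / C)); split; first by rewrite lt_min C0 divr_gt0.
    by rewrite ge_min lexx.
  by rewrite -ler_pdivlMr // ge_min lexx orbT.
clearbody C; exists e2; split=> //.
exists (maxn N1 (maxn N2 N3)) => N A B n; rewrite !geq_max => /and3P[n1 n2 n3] hA hB.
set P := (p ^ N)%N in hA hB *; have aP : abs (P%:R : K) = rad N by apply: abs_pXn.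
have rN := rad_gt0 N; have rN1 := rad_le1 N.
pose r a := A a - f a - P%:R * s * f' a; pose t a := B a - g a - P%:R * s * g' a.
pose b a := ((n + (P - a)) %% P)%N.
have -> : cyc P A B n - cyc P f g n = P%:R * s * cyc P f' g n + P%:R * s * cyc P f g' n +
  (P%:R * s) ^+ 2 * cyc P f' g' n +
  \sum_(a < P) (r a * B (b a) + (f a + P%:R * s * f' a) * t (b a)).
  rewrite /cyc !mulr_sumr -sumrB -!big_split /=; apply: eq_bigr => a _.
  by rewrite /r /t -/(b a); ring.
have ep2 : rad N * p%:R * (e / p%:R ^+ 2) <= e * rad N.
  have -> : rad N * p%:R * (e / p%:R ^+ 2) = e * rad N * p%:R^-1 by field; rewrite gt_eqF.
  by rewrite ler_piMr ?mulr_ge0 ?(ltW e0) ?(ltW rN) // invf_le1 // ltW.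
have sP : abs (P%:R * s) <= rad N * p%:R by apply: absM_le; rewrite ?aP.
apply: absD_le; [apply: absD_le; [apply: absD_le|]|].
- by apply: le_trans (absM_le _ _ _ _ sP (hN1 N n1 n)) ep2.
- by apply: le_trans (absM_le _ _ _ _ sP (hN2 N n2 n)) ep2.
- rewrite expr2; apply: le_trans (absM_le _ _ _ _ (absM_le _ _ _ _ sP sP) (hN3 N n3 n)) _.
  have -> : rad N * p%:R * (rad N * p%:R) * (e / p%:R ^+ 2) = rad N * (e * rad N).
    by field; rewrite gt_eqF.
  by rewrite ler_piMl // mulr_ge0 ?(ltW e0) ?(ltW rN).
have hPs (h : nat -> K) c : 0 < c -> c <= C1 + C2 + C3 + C4 -> (forall a, abs (h a) <= c) ->
    forall a, abs (P%:R * s * h a) <= C.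
  move=> c0 hc hh a; apply: le_trans (absM_le _ _ _ _ _ (hh a)) (Cge p%:R c _ _ _ _) => //.
  - by apply: le_trans sP _; rewrite ler_piMl // ltW.
  - exact: ltW.
have fB a : abs (f a + P%:R * s * f' a) <= C.
  apply: absD_le; last by apply: (hPs _ C2) => //; lra.
  by apply: le_trans (h1 a) _; apply: Cge1; lra.
have BB a : abs (B a) <= C.
  rewrite (_ : B a = t a + (g a + P%:R * s * g' a)); last by rewrite /t; ring.
  apply: absD_le.
    apply: le_trans (hB a) _; apply: le_trans e2C; rewrite ler_piMr //; exact: ltW.
  apply: absD_le; last by apply: (hPs _ C4) => //; lra.
  by apply: le_trans (h3 a) _; apply: Cge1; lra.
apply: abs_sum_le => [|a _]; first by rewrite mulr_ge0 ?(ltW e0) ?(ltW rN).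
have fin : e2 * rad N * C <= e * rad N by rewrite mulrAC; apply: ler_wpM2r => //; exact: ltW.
apply: absD_le; apply: le_trans fin; first by apply: absM_le; [exact: hA | exact: BB].
by rewrite [X in abs X]mulrC; apply: absM_le; [exact: hB | exact: fB].
Qed.

(** * Volkenborn integrals over residue classes *)

Lemma sdiff_id : sdiff (fun x => x%:R) (fun _ => 1).
Proof.
split=> e e0; exists 0%N => x y _; first by rewrite subrr abs0 ltW.
by rewrite mulr1 subrr abs0 mulr_ge0 ?abs_nneg // ltW.
Qed.

(* Its value is -1/2, but only the bound |sigma| <= p matters. *)
Definition sigma : K := lim_seq abs (vol (fun x => x%:R)).

Lemma sigma_conv : conv (vol (fun x => x%:R)) sigma.
Proof. by apply: lim_conv; apply: vol_conv sdiff_id. Qed.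

Lemma abs_sigma : abs sigma <= p%:R.
Proof.
rewrite -[sigma]subr0; apply: (conv_le_lim _ _ _ _ 0%N sigma_conv pR_gt0) => n _.
by rewrite subr0; apply: abs_divX; apply: abs_sum_id.
Qed.

(** The Volkenborn integral of u over the class a + p^N Z_p, multiplied by p^N. *)
Definition block (u : nat -> K) (N a : nat) : K :=
  lim_seq abs (vol (fun y => u (a + p ^ N * y)%N)).

Lemma block_conv u u' N a : sdiff u u' ->
  conv (vol (fun y => u (a + p ^ N * y)%N)) (block u N a).
Proof.
move=> [h1 h2]; apply: lim_conv; apply: (vol_conv _ (fun y => (p ^ N)%:R * u' (a + p ^ N * y)%N)).
have E x y : (a + p ^ N * x)%:R - (a + p ^ N * y)%:R = (p ^ N)%:R * (x%:R - y%:R) :> K.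
  by rewrite !natrD !natrM; ring.
have le x y : abs ((a + p ^ N * x)%:R - (a + p ^ N * y)%:R) <= abs (x%:R - y%:R).
  by rewrite E (absM HK) ler_piMl ?abs_nneg // abs_nat.
split=> e e0.
  have [k hk] := h1 e e0; exists k => x y hxy; rewrite -mulrBr -[e]mul1r.
  by apply: absM_le; rewrite ?abs_nat //; apply: hk; apply: le_trans hxy.
have [k hk] := h2 e e0; exists k => x y hxy.
have -> : (x%:R - y%:R) * ((p ^ N)%:R * u' (a + p ^ N * x)%N) =
  ((a + p ^ N * x)%:R - (a + p ^ N * y)%:R) * u' (a + p ^ N * x)%N by rewrite E; ring.
apply: le_trans (hk _ _ (le_trans (le x y) hxy)) _.
by apply: ler_wpM2l => //; exact: ltW.
Qed.

(** Integrate u(a + p^N y) = u(a) + p^N y u'(a) + r(y) in y, where y has integral sigma. By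
    [sdiff_aff] the remainder r has Lipschitz constant (e / p) p^-N, and it vanishes at 0, so
    [lip_sum] bounds its integral. *)
Lemma block_approx u u' e : sdiff u u' -> 0 < e -> exists k, forall N, (k <= N)%N -> forall a,
  abs (block u N a - u a - (p ^ N)%:R * sigma * u' a) <= e * rad N.
Proof.
move=> hu e0; have p0 := pR_gt0.
have [k hk] := sdiff_aff _ _ hu (e / p%:R) (divr_gt0 e0 p0); exists k => N kN a.
have rN := rad_gt0 N.
have cv := convB _ _ _ _ (convB _ _ _ _ (block_conv _ _ N a hu) (conv_cst (u a)))
  (convZ _ _ ((p ^ N)%:R * u' a) sigma_conv).
rewrite mulrAC -[_ - _ - _]subr0.
apply: (conv_le_lim _ _ _ _ 0%N cv); first by rewrite mulr_gt0.
move=> m _; rewrite subr0 /vol.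
have E : (\sum_(y < p ^ m) u (a + p ^ N * y)%N) / (p ^ m)%:R - u a -
   (p ^ N)%:R * u' a * ((\sum_(x < p ^ m) x%:R) / (p ^ m)%:R) =
  (\sum_(y < p ^ m) (u (a + p ^ N * y)%N - u a - (p ^ N)%:R * y%:R * u' a)) / (p ^ m)%:R.
  rewrite !sumrB sumr_const card_ord -mulr_suml -mulr_sumr -[u a *+ _]mulr_natl.
  by field; rewrite pXn_neq0.
rewrite E; apply: abs_divX.
apply: le_trans (lip_sum (fun y => u (a + p ^ N * y)%N - u a - (p ^ N)%:R * y%:R * u' a)
   (e / p%:R * rad N) m _ _ _) _.
- by apply: ltW; rewrite mulr_gt0 // divr_gt0.
- by rewrite muln0 addn0 subrr mulr0 mul0r subr0.
- move=> x y _ _; rewrite (_ : _ - _ - _ = u (a + p ^ N * x)%N - u (a + p ^ N * y)%N -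
     (p ^ N)%:R * (x%:R - y%:R) * u' a); [exact: hk | ring].
by rewrite le_eqVlt; apply/orP; left; apply/eqP; field; rewrite gt_eqF.
Qed.

(** * Fourier inversion on the roots of unity *)

Local Notation roots := (roots_pn K p).

Lemma Xn_sub1_roots m : (0 < m)%N ->
  exists s : seq K, [/\ uniq s, size s = m & forall w, w \in s <-> w ^+ m = 1].
Proof.
move=> m0; have [r Dp] := closed_field_poly_normal ('X^m - 1 : {poly K}).
have lc : lead_coef ('X^m - 1 : {poly K}) = 1 by apply/eqP/monic_Xn_sub_1.
rewrite lc scale1r in Dp; exists r; split.
- by rewrite -separable_prod_XsubC -Dp separable_Xn_sub_1 // natK_neq0.
- by apply/eqP; rewrite -eqSS -(size_prod_XsubC _ id) -Dp size_Xn_sub_1.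
by move=> w; rewrite -root_prod_XsubC -Dp; split => /unity_rootP.
Qed.

Lemma roots_pnP n : uniq (roots n) /\ forall w, w \in roots n <-> w ^+ (p ^ n) = 1.
Proof.
apply: (epsilon_spec (inhabits [::])
    (fun s : seq K => uniq s /\ forall w, w \in s <-> w ^+ (p ^ n) = 1)).
by have [s [us _ hs]] := Xn_sub1_roots _ (pXn_gt0 n); exists s.
Qed.

Lemma roots_sum n m :
  \sum_(w <- roots n) w ^+ m = if (p ^ n %| m)%N then (p ^ n)%:R else 0.
Proof.
have [ur hr] := roots_pnP n; have [s [us ss hs]] := Xn_sub1_roots _ (pXn_gt0 n).
have pr : perm_eq (roots n) s by apply: uniq_perm => // w; apply/idP/idP => [/hr/hs|/hs/hr].
case: ifP => [/dvdnP[k ->]|nd].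
  rewrite (eq_big_seq (fun _ => 1)) => [|w /hr hw]; last by rewrite mulnC exprM hw expr1n.
  by rewrite (perm_big _ pr) big_const_seq count_predT ss iter_addr addr0.
have [z prim] : exists z : K, (p ^ n).-primitive_root z.
  have /hasP[z _ hz] : has (p ^ n).-primitive_root s; last by exists z.
  apply: has_prim_root; rewrite ?pXn_gt0 ?ss //.
  by apply/allP => w /hs hw; apply/unity_rootP.
have zm : z ^+ m != 1 by rewrite -(prim_order_dvd prim) nd.
have zr : z ^+ (p ^ n) = 1 by apply: prim_expr_order.
have z0 : z != 0.
  by apply/eqP => e; move: zr; rewrite e expr0n (gtn_eqF (pXn_gt0 n)) => /esym/eqP; rewrite oner_eq0.
(* Multiplication by the primitive root z permutes the roots, hence multiplies the sum by z^m, which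
   is not 1. *)
have pm : perm_eq (roots n) (map ( *%R z) (roots n)).
  apply: uniq_perm => //; first by rewrite map_inj_uniq //; apply: mulfI.
  move=> w; apply/idP/mapP => [/hr hw|[v /hr hv ->]].
    by exists (z^-1 * w); rewrite ?mulVKf //; apply/hr; rewrite exprMn exprVn zr invr1 mul1r.
  by apply/hr; rewrite exprMn zr mul1r.
have : \sum_(w <- roots n) w ^+ m = z ^+ m * \sum_(w <- roots n) w ^+ m.
  rewrite {1}(perm_big _ pm) big_map mulr_sumr; apply: eq_bigr => w _.
  by rewrite exprMn.
move/eqP; rewrite -subr_eq0 -{1}[X in X - _]mul1r -mulrBl mulf_eq0 subr_eq0 eq_sym (negPf zm).
by move/eqP.
Qed.

Definition hat (N : nat) (A : nat -> K) (w : K) : K :=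
  (\sum_(a < p ^ N) w ^+ a * A a) / (p ^ N)%:R.

(** Convolution theorem on Z/p^N: orthogonality keeps only b congruent to n - a, and the
    normalisations P^-2 and the sum P of the surviving roots leave P^-1. *)
Lemma roots_hat N A B n : (n < p ^ N)%N ->
  \sum_(w <- roots N) hat N A w * hat N B w * w^-1 ^+ n = cyc (p ^ N) A B n / (p ^ N)%:R.
Proof.
move=> hn; have [_ hr] := roots_pnP N; have P0 := pXn_neq0 N; set P := (p ^ N)%N in hn hr P0 *.
rewrite (eq_big_seq (fun w => \sum_(a < P) \sum_(b < P)
   (A a * B b / P%:R ^+ 2) * w ^+ (a + b + (P - n)))); last first.
  move=> w /hr hw; have -> : w^-1 ^+ n = w ^+ (P - n).
    have w0 : w != 0.
      apply/eqP => e; move: hw; rewrite e expr0n (gtn_eqF (leq_ltn_trans (leq0n n) hn)).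
      by move/esym/eqP; rewrite oner_eq0.
    by rewrite exprVn -[LHS]mul1r -hw -{1}(subnK (ltnW hn)) exprD mulfK // expf_neq0.
  rewrite /hat -/P mulrACA -invfM -expr2 big_distrlr /= mulr_suml mulr_suml.
  apply: eq_bigr => a _; rewrite mulr_suml mulr_suml; apply: eq_bigr => b _.
  by rewrite !exprD; ring.
rewrite exchange_big /= /cyc mulr_suml; apply: eq_bigr => a _.
rewrite exchange_big /=.
have hb : ((n + (P - a)) %% P < P)%N by rewrite ltn_mod; apply: leq_ltn_trans hn.
rewrite (bigD1 (Ordinal hb)) //= -mulr_sumr roots_sum -/P.
have ha := ltn_ord a.
(* Both sides of the congruence are compared after adding a + (P - n), which turns the right one
   into 2 P. *)
have dv (b : nat) : (b < P)%N -> (P %| a + b + (P - n))%N = (b == (n + (P - a)) %% P)%N.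
  move=> bP; rewrite -[X in X == _](modn_small bP) -(eqn_modDr (a + (P - n))).
  rewrite (_ : n + (P - a) + (a + (P - n)) = 2 * P)%N; last by lia.
  by rewrite modnMl addnCA addnA.
rewrite dv // eqxx big1 ?addr0; first by field.
move=> b nb; rewrite -mulr_sumr roots_sum -/P dv // ifF ?mulr0 //.
by apply: contra_neqF nb => /eqP e; apply/val_inj.
Qed.

Lemma vol_mul_block N w u k : w ^+ (p ^ N) = 1 ->
  vol (fun x => w ^+ x * u x) (N + k) =
  hat N (fun a => vol (fun y => u (a + p ^ N * y)%N) k) w.
Proof.
move=> hw; rewrite /vol /hat expnD (sum_ord_mul _ (fun x => w ^+ x * u x)) natrM invfM mulrA.
rewrite mulrAC; congr (_ / _); rewrite mulr_suml; apply: eq_bigr => a _.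
rewrite mulrA; congr (_ / _); rewrite mulr_sumr; apply: eq_bigr => y _.
by rewrite exprD exprM hw expr1n mulr1.
Qed.

Lemma vol_root_conv N w u u' : w ^+ (p ^ N) = 1 -> sdiff u u' ->
  conv (vol (fun x => w ^+ x * u x)) (hat N (block u N) w).
Proof.
move=> hw hu; apply/(conv_shift _ _ N).
apply: (conv_eq (fun k => hat N (fun a => vol (fun y => u (a + p ^ N * y)%N) k) w) _ _ 0%N).
  by move=> k _; rewrite addnC vol_mul_block.
rewrite /hat mulrC; apply: (conv_eq (fun k => (p ^ N)%:R^-1 *
  \sum_(a < p ^ N) w ^+ a * vol (fun y => u (a + p ^ N * y)%N) k) _ _ 0%N).
  by move=> k _; rewrite mulrC.
apply: convZ; apply: conv_sum => a; apply: convZ; exact: block_conv hu.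
Qed.

Lemma hat_cyc_conv u u' v v' (n : nat -> nat) : sdiff u u' -> sdiff v v' ->
  (forall N, (n N < p ^ N)%N) ->
  conv (fun N => \sum_(w <- roots N) hat N (block u N) w * hat N (block v N) w * w^-1 ^+ n N
     - cyc (p ^ N) u v (n N) / (p ^ N)%:R) 0.
Proof.
move=> hu hv hn; apply: convI0 => e e0.
have [e2 [e20 [N0 h]]] := cyc_perturb u u' v v' sigma e (sdiff_scont _ _ hu) (proj1 hu)
  (sdiff_scont _ _ hv) (proj1 hv) abs_sigma e0.
have [k1 h1] := block_approx _ _ _ hu e20; have [k2 h2] := block_approx _ _ _ hv e20.
exists (maxn N0 (maxn k1 k2)) => N; rewrite !geq_max => /and3P[n0 n1 n2].
rewrite roots_hat // -mulrBl; apply: abs_divX; apply: h => // a; [exact: h1 | exact: h2].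
Qed.

(** * Powers, exponential and logarithm *)

Lemma geo_small (r e : R) : 0 <= r -> r < 1 -> 0 < e ->
  exists N, forall k, (N <= k)%N -> r ^+ k <= e.
Proof.
move=> r0; rewrite le0r in r0; case/orP: r0 => [/eqP ->|r0] r1 e0.
  by exists 1%N => -[|k] // _; rewrite expr0n /= ltW.
have [h hh] : exists h, r^-1 = 1 + h by exists (r^-1 - 1); ring.
have h0 : 0 < h.
  have h1 : 1 < r^-1 by rewrite invf_gt1.
  by lra.
have [n hn] : exists n : nat, e^-1 / h <= n%:R.
  by exists (Num.bound (e^-1 / h)); apply/ltW/archi_boundP; apply: divr_ge0; rewrite ?invr_ge0; apply: ltW.
have bern k : 1 + k%:R * h <= r^-1 ^+ k.
  elim: k => [|k IH]; first by rewrite mul0r addr0 expr0.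
  rewrite exprS hh in IH *; have k0 : 0 <= k%:R :> R by apply: ler0n.
  apply: (@le_trans _ _ ((1 + h) * (1 + k%:R * h))).
    by rewrite -natr1; nra.
  by rewrite ler_pM2l //; lra.
exists n => k nk; rewrite -[r ^+ k]invrK -[e]invrK lef_pV2 ?posrE ?invr_gt0 ?exprn_gt0 //.
rewrite -exprVn; apply: le_trans (bern k).
rewrite ler_pdivrMr // in hn; apply: (le_trans hn).
have : n%:R * h <= k%:R * h by rewrite ler_pM2r // ler_nat.
by lra.
Qed.

Lemma bigmax_bound (h : nat -> R) m : exists B, 0 < B /\ forall k, (k < m)%N -> h k <= B.
Proof.
elim: m => [|m [B [B0 hB]]]; first by exists 1; split.
exists (Num.max B (h m)); split; first by rewrite lt_max B0.
move=> k; rewrite ltnS leq_eqVlt => /predU1P[->|/hB hk]; first by rewrite le_max lexx orbT.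
by rewrite le_max hk.
Qed.

Lemma prod_close x y k : abs x <= 1 -> abs y <= 1 ->
  abs (\prod_(i < k) (x - i%:R)) <= 1 /\
  abs (\prod_(i < k) (x - i%:R) - \prod_(i < k) (y - i%:R)) <= abs (x - y).
Proof.
move=> hx hy; elim: k => [|k [h1 h2]].
  by rewrite !big_ord0 abs1 subrr abs0 abs_nneg.
rewrite !big_ord_recr /=; set X := \prod_(i < k) (x - _) in h1 h2 *.
set Y := \prod_(i < k) (y - _) in h2 *.
have xk : abs (x - k%:R) <= 1 by apply: absB_le; rewrite ?abs_nat.
have yk : abs (y - k%:R) <= 1 by apply: absB_le; rewrite ?abs_nat.
split; first by apply: le_trans (absM_le _ _ _ _ h1 xk) _; rewrite mulr1.
have -> : X * (x - k%:R) - Y * (y - k%:R) = X * (x - y) + (X - Y) * (y - k%:R) by ring.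
apply: absD_le.
  by rewrite -[abs (x - y)]mul1r; apply: absM_le.
by rewrite -[abs (x - y)]mulr1; apply: absM_le.
Qed.

Lemma fact_neq0 k : (k`!)%:R != 0 :> K.
Proof. by apply: natK_neq0; apply: fact_gt0. Qed.

Lemma binK_close x y k : abs x <= 1 -> abs y <= 1 ->
  abs (binK x k - binK y k) <= abs (x - y) / abs (k`!)%:R.
Proof.
move=> hx hy; rewrite /binK -mulrBl (absM HK) absV; apply: ler_wpM2r.
  by rewrite invr_ge0 abs_nneg.
by have [] := prod_close x y k hx hy.
Qed.

Lemma binK_nat n k : binK n%:R k = ('C(n, k))%:R :> K.
Proof.
have prodE : \prod_(i < k) (n%:R - i%:R) = (n ^_ k)%:R :> K.
  elim: k => [|k IH]; first by rewrite big_ord0 ffactn0.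
  rewrite big_ord_recr /= IH ffactnSr natrM; case: (leqP k n) => h; first by rewrite natrB.
  by rewrite ffact_small // !mul0r.
by rewrite /binK prodE -bin_ffact natrM mulfK // fact_neq0.
Qed.

Lemma binK_N1 k : binK (-1) k = (-1) ^+ k :> K.
Proof.
have prodE : \prod_(i < k) (-1 - i%:R) = (-1) ^+ k * (k`!)%:R :> K.
  elim: k => [|k IH]; first by rewrite big_ord0 mulr1.
  by rewrite big_ord_recr /= IH factS natrM exprS -natr1; ring.
by rewrite /binK prodE mulfK // fact_neq0.
Qed.

Lemma binomial_sum (a : K) n m : (n < m)%N ->
  \sum_(k < m) binK n%:R k * (a - 1) ^+ k = a ^+ n.
Proof.
move=> nm; rewrite -{2}(subrK 1 a) exprD1n -(subnKC nm) big_split_ord /=.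
rewrite [X in _ + X]big1 ?addr0; last first.
  by move=> i _; rewrite binK_nat bin_small ?mul0r //; lia.
by apply: eq_bigr => i _; rewrite binK_nat mulr_natl.
Qed.

Lemma phi_nat (a : K) n : phi abs a n%:R = a ^+ n.
Proof.
apply: limE; apply: (conv_eq (fun _ => a ^+ n) _ _ n.+1); last exact: conv_cst.
by move=> m nm; rewrite binomial_sum.
Qed.

(** Roots of unity of p-power order are principal units. With v = w - 1 of absolute value at least
    1, v^p would dominate both w^p - 1 and the middle binomial terms, which are divisible by p; this
    contradicts the expansion of w^p. *)
Lemma abs_root n (w : K) : w ^+ (p ^ n) = 1 -> abs (w - 1) < 1.
Proof.
suff : abs (w ^+ (p ^ n) - 1) < 1 -> abs (w - 1) < 1.
  by move=> h hw; apply: h; rewrite hw subrr abs0.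
elim: n w => [|n IH] w; first by rewrite expn0 expr1.
rewrite expnS exprM => /IH; set v := w - 1 => h.
have pp : (p.-1.+1 = p)%N by rewrite prednK ?p_gt0.
have ew : v + 1 = w by apply: subrK.
have [//|v1] := ltP (abs v) 1.
have vp : abs (v ^+ p) < abs v ^+ p.
  have E : v ^+ p = (w ^+ p - 1) - \sum_(i < p.-1) v ^+ i.+1 *+ 'C(p, i.+1).
    have := exprD1n v p.-1.+1; rewrite big_ord_recl big_ord_recr /= /bump /= !add1n.
    rewrite pp ew => ->; rewrite bin0 binn expr0 !mulr1n.
    rewrite (eq_bigr (fun i : 'I_p.-1 => v ^+ i.+1 *+ 'C(p, i.+1))) //.
    by ring.
  rewrite {1}E; apply: (@absD_lt _ (- _)).
    by apply: lt_le_trans h _; apply: exprn_ege1.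
  rewrite absN.
  have : abs (\sum_(i < p.-1) v ^+ i.+1 *+ 'C(p, i.+1)) <= (p%:R)^-1 * abs v ^+ p.
    apply: abs_sum_le => [|i _].
      by rewrite mulr_ge0 ?exprn_ge0 ?abs_nneg // invr_ge0 ler0n.
    have hi := ltn_ord i.
    rewrite -mulr_natl; apply: absM_le.
      have : (p ^ 1 %| 'C(p, i.+1))%N by rewrite expn1 prime_dvd_bin //; lia.
      by rewrite -abs_dvd /rad expr1.
    by rewrite absX; apply: ler_weXn2l => //; lia.
  move=> h2; apply: le_lt_trans h2 _; rewrite gtr_pMl ?invf_lt1 ?pR_gt0 ?pR_gt1 //.
  by apply: exprn_gt0; lra.
by rewrite absX ltxx in vp.
Qed.

(** The binomial series at z is compared with the finite one at a natural m close to z. Terms of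
    index at least k0 are small through the powers of w - 1, the others through the closeness of z
    and m. *)
Lemma phi_root n (w z : K) : w ^+ (p ^ n) = 1 -> Zp z -> phi abs w z = w ^+ tr n z.
Proof.
move=> hw hz; apply: limE; apply: convI => e e0.
have w1 := abs_root n w hw; set v := w - 1 in w1 *; have v0 := abs_nneg v.
have [k0 hk0] := geo_small _ e v0 w1 e0.
have [B [B0 hB]] := bigmax_bound (fun k => (abs (k`!)%:R)^-1) k0.
have [N1 hN1] := rad_small (e / B) (divr_gt0 e0 B0).
(* Precision n makes w^m the right power; precision N1 controls the finitely many binomials with k <
   k0, whose denominators k! are bounded by B. *)
set N := maxn n N1; set m := tr N z.
have zm : abs (z - m%:R) <= rad N by apply: abs_tr.
exists m.+1 => M mM.
have -> : w ^+ tr n z = w ^+ m.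
  have : abs (m%:R - (tr n z)%:R) <= rad n.
    apply: (abs_chain z); last exact: abs_tr.
    by rewrite absBC; apply: le_trans zm (rad_le _ _ (leq_maxl _ _)).
  by rewrite abs_mod => /eqP hmod; rewrite -(expr_mod _ hw) -hmod expr_mod.
rewrite -(binomial_sum w m M mM) -sumrB; apply: abs_sum_le => [|k _]; first exact: ltW.
rewrite -mulrBl -/v (absM HK) absX.
have z1 : abs z <= 1 by apply: Zp_abs.
have cl := binK_close z m%:R k z1 (abs_nat m).
case: (leqP k0 k) => hk.
  rewrite -[e]mul1r; apply: ler_pM; rewrite ?abs_nneg ?exprn_ge0 //; last exact: hk0.
  apply: absB_le; last by rewrite binK_nat abs_nat.
  have f0 : 0 < abs (k`!)%:R by rewrite abs_gt0 fact_neq0.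
  (* Integrality of binom(z, k): a natural number closer to z than the size of k! has a binomial
     within 1. *)
  have [N2 hN2] := rad_small _ f0.
  have cl2 := binK_close z (tr N2 z)%:R k z1 (abs_nat _).
  rewrite -(subrK (binK (tr N2 z)%:R k) (binK z k)); apply: absD_le.
    apply: le_trans cl2 _; rewrite ler_pdivrMr // mul1r.
    by apply: le_trans (abs_tr N2 z hz) (hN2 _ (leqnn _)).
  by rewrite binK_nat abs_nat.
rewrite -[e]mulr1; apply: ler_pM; rewrite ?abs_nneg ?exprn_ge0 //; last first.
  by apply: exprn_ile1 => //; apply: ltW.
apply: le_trans cl _.
apply: (@le_trans _ _ (e / B * B)); last by rewrite divfK ?gt_eqF.
apply: ler_pM; rewrite ?abs_nneg ?invr_ge0 ?abs_nneg //; last exact: hB.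
by apply: le_trans zm (hN1 _ (leq_maxr _ _)).
Qed.

(** Legendre's bound, by strong induction from v(n!) = b + v(b!) with b the quotient of n by p, and
    p b <= n. *)
Lemma logn_fact_lt n : (0 < n)%N -> (p.-1 * logn p n`! < n)%N.
Proof.
elim/ltn_ind: n => n IH n0; rewrite logn_fact // big_nat_recl //= expn1.
have p1 := prime_gt1 p_prime.
have [q0|q0] := posnP (n %/ p)%N.
  rewrite q0 big1_seq ?muln0 // => i _.
  by rewrite expnS divnMA q0 div0n.
have qn : (n %/ p < n)%N by apply: ltn_Pdiv.
have -> : (\sum_(1 <= i < n) n %/ p ^ i.+1 = logn p (n %/ p)`!)%N.
  rewrite logn_fact // (big_cat_nat (n := (n %/ p).+1)) //=.
  rewrite [X in (_ + X)%N]big1_seq ?addn0; last first.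
    move=> i; rewrite mem_index_iota => /= /andP[hi _].
    rewrite expnS divnMA divn_small //.
    by apply: ltn_trans hi _; apply: ltn_expl.
  by apply: eq_bigr => i _; rewrite expnS divnMA.
have := IH _ qn q0; have := leq_divM n p; rewrite mulnDr.
move: (logn p _) => a; move: (n %/ p)%N => b.
have : (p = p.-1.+1)%N by rewrite prednK ?p_gt0.
move: (p.-1) => c ->; rewrite mulnS.
by rewrite [(b * c)%N]mulnC; move: (c * b)%N (c * a)%N => x y; lia.
Qed.

(* The radius of convergence p^(-1/(p-1)) of exp. *)
Definition rexp : R := p%:R `^ (- (p%:R - 1)^-1).

Lemma rexp_gt0 : 0 < rexp. Proof. exact: powR_gt0 pR_gt0. Qed.

Lemma rexpX : rexp ^+ p.-1 = p%:R^-1.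
Proof.
rewrite /rexp -powR_mulrn ?powR_ge0 // -powRrM mulNr.
have -> : (p.-1)%:R = p%:R - 1 :> R by rewrite -[in RHS](prednK p_gt0) -natr1 addrK.
rewrite mulVf ?powR_inv1 ?ler0n // subr_eq0; have := pR_gt1; lra.
Qed.

Lemma rexp_lt1 : rexp < 1.
Proof.
have p1 : (0 < p.-1)%N by have := prime_gt1 p_prime; lia.
rewrite -(expr_lt1 p1 (ltW rexp_gt0)) rexpX invf_lt1 ?pR_gt0 //; exact: pR_gt1.
Qed.

(** With v the valuation of (k + 1)!, Legendre gives (p - 1) v <= k, and p^-v = [rexp] ^ ((p - 1)
    v). *)
Lemma abs_fact_ge k : rexp ^+ k <= abs (k.+1`!)%:R.
Proof.
have -> : abs (k.+1`!)%:R = rad (logn p k.+1`!).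
  have [m cop e] := pfactor_coprime p_prime (fact_gt0 k.+1).
  by rewrite {1}e natrM (absM HK) abs_coprime // mul1r abs_pXn.
have := logn_fact_lt k.+1 isT; rewrite ltnS => h.
rewrite /rad -exprVn -rexpX -exprM.
apply: ler_wiXn2l => //; [exact/ltW/rexp_gt0 | exact/ltW/rexp_lt1].
Qed.

Lemma rho_ge0 t : 0 <= abs t / rexp.
Proof. by rewrite divr_ge0 ?abs_nneg // ltW // rexp_gt0. Qed.

Lemma rho_lt1 t : abs t < rexp -> abs t / rexp < 1.
Proof. by move=> ht; rewrite ltr_pdivrMr ?mul1r // rexp_gt0. Qed.

Lemma abs_lt1 t : abs t < rexp -> abs t < 1.
Proof. by move=> ht; exact: lt_trans ht rexp_lt1. Qed.

Lemma abs_exp_term t k : abs (t ^+ k.+1 / (k.+1`!)%:R) <= abs t * (abs t / rexp) ^+ k.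
Proof.
rewrite (absM HK) absV absX expr_div_n exprS -mulrA; apply: ler_wpM2l.
  exact: abs_nneg.
apply: ler_wpM2l; first by rewrite exprn_ge0 ?abs_nneg.
rewrite lef_pV2 ?posrE ?abs_fact_ge // ?exprn_gt0 ?rexp_gt0 //.
by rewrite abs_gt0 fact_neq0.
Qed.

Lemma abs_exp_term_le t k : abs (t ^+ k / (k`!)%:R) <= (abs t / rexp) ^+ k.
Proof.
case: k => [|k]; first by rewrite !expr0 fact0 divr1 abs1.
apply: le_trans (abs_exp_term t k) _; rewrite exprS; apply: ler_wpM2r.
  by rewrite exprn_ge0 // rho_ge0.
rewrite ler_pdivlMr ?rexp_gt0 // ler_piMr ?abs_nneg //.
exact/ltW/rexp_lt1.
Qed.

(** Since k + 1 divides (k + 1)!, the bound for exp also serves for log, and one disc suffices for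
    both. *)
Lemma abs_log_term t k : abs (t ^+ k.+1 / k.+1%:R) <= abs t * (abs t / rexp) ^+ k.
Proof.
apply: le_trans (abs_exp_term t k); rewrite factS natrM invfM mulrA [X in _ <= X](absM HK).
rewrite ler_peMr ?abs_nneg //.
rewrite absV invf_ge1 ?abs_nat // abs_gt0; exact: fact_neq0.
Qed.

Lemma geo_series (a : nat -> K) (r C : R) : 0 <= r -> r < 1 ->
  (forall k, abs (a k) <= C * r ^+ k) -> exists l, conv (fun n => \sum_(k < n) a k) l.
Proof.
move=> r0 r1 h; apply: cauchy_conv => e e0.
have C0 : 0 <= C by apply: le_trans (abs_nneg (a 0%N)) _; rewrite -[C]mulr1 -(expr0 r).
have [N hN] := geo_small r (e / (C + 1)) r0 r1 ltac:(by apply: divr_gt0; lra).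
exists N => n /hN hn; rewrite big_ord_recr /= addrAC subrr add0r.
apply: le_trans (h n) _; apply: (@le_trans _ _ (C * (e / (C + 1)))); first exact: ler_wpM2l.
by rewrite mulrA ler_pdivrMr; [rewrite mulrC ler_pM2l //; lra | lra].
Qed.

Lemma expK_conv t : abs t < rexp ->
  conv (fun n => \sum_(k < n) t ^+ k / (k`!)%:R) (expK abs t).
Proof.
move=> ht; apply: lim_conv.
apply: (geo_series (fun k => t ^+ k / (k`!)%:R) _ 1 (rho_ge0 t) (rho_lt1 t ht)) => k.
by rewrite mul1r; apply: abs_exp_term_le.
Qed.

Lemma sum_triangle (V : nmodType) (F : nat -> nat -> V) n :
  \sum_(k < n) \sum_(i < k.+1) F i (k - i)%N =
  \sum_(i < n) \sum_(j < n | (i + j < n)%N) F i j.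
Proof.
transitivity (\sum_(k < n) \sum_(i < n | (i <= k)%N) F i (k - i)%N).
  apply: eq_bigr => k _.
  by rewrite (big_ord_widen_cond n predT (fun i => F i (k - i)%N)) //=.
rewrite (exchange_big_dep predT) //=; apply: eq_bigr => i _; have hi := ltn_ord i.
rewrite -(big_mkord (fun k => i <= k)%N (fun k => F i (k - i)%N)).
rewrite -(big_mkord (fun j => i + j < n)%N (fun j => F i j)).
rewrite (big_cat_nat (n := i)) ?(ltnW hi) //= big1_seq ?add0r; last first.
  by move=> k; rewrite mem_index_iota => /andP[ik /andP[_ ki]]; move: ik; rewrite leqNgt ki.
rewrite [RHS](big_cat_nat (n := (n - i)%N)) ?leq_subr //= [X in _ = _ + X]big1_seq ?addr0; last first.
  move=> k; rewrite mem_index_iota => /andP[ik /andP[ki _]]; move: ki.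
  by rewrite leq_subLR leqNgt ik.
rewrite -{1}[i : nat]add0n big_addn big_nat_cond [RHS]big_nat_cond.
apply: eq_big => [j|j _]; last by rewrite addnK.
by rewrite leq_addl andbT /= -ltn_subRL andbb.
Qed.

Lemma expKD s t : abs s < rexp -> abs t < rexp ->
  expK abs (s + t) = expK abs s * expK abs t.
Proof.
move=> hs ht; have hst : abs (s + t) < rexp by apply: absD_lt.
apply: (conv_uniq _ _ _ (expK_conv _ hst)).
have := convM _ _ _ _ (expK_conv _ hs) (expK_conv _ ht); set l := _ * _ => hl.
rewrite -[l]addr0.
pose c k : K := s ^+ k / (k`!)%:R; pose d k : K := t ^+ k / (k`!)%:R.
pose E n : K := \sum_(k < n) (s + t) ^+ k / (k`!)%:R.
suff h : conv (fun n => E n - (\sum_(k < n) c k) * (\sum_(k < n) d k)) 0.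
  have := convD _ _ _ _ hl h; apply: (conv_eq _ _ _ 0%N) => n _.
  by rewrite addrCA subrr addr0.
set r := Num.max (abs s / rexp) (abs t / rexp).
have r0 : 0 <= r by rewrite le_max rho_ge0.
have r1 : r < 1 by rewrite gt_max !rho_lt1.
apply: convI0 => e e0; have [N hN] := geo_small r e r0 r1 e0.
exists N => n nN.
have -> : E n = \sum_(i < n) \sum_(j < n | (i + j < n)%N) c i * d j.
  rewrite -(sum_triangle _ (fun i j => c i * d j)); apply: eq_bigr => k _.
  rewrite addrC exprDn mulr_suml; apply: eq_bigr => i _; have hi := ltn_ord i.
  rewrite ltnS in hi; have := bin_fact hi => hb.
  rewrite -(mulr_natl _ 'C(k, i)) /c /d -hb !natrM.
  field; rewrite !fact_neq0 /= natK_neq0 // bin_gt0 //.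
(* The square of index pairs minus the triangle leaves i + j >= n, where every term is at most r^n
   in size. *)
rewrite big_distrlr /= -sumrB; apply: abs_sum_le => [|i _]; first exact: ltW.
rewrite [X in _ - X](bigID (fun j : 'I_n => (i + j < n)%N)) /= opprD addrA subrr add0r absN.
apply: abs_sum_le => [|j]; first exact: ltW.
rewrite -leqNgt => hij; apply: (@le_trans _ _ (r ^+ (i + j))); last by apply: hN; apply: leq_trans hij.
rewrite exprD; apply: absM_le.
  apply: le_trans (abs_exp_term_le s i) _; apply: lerXn2r; rewrite ?nnegrE ?rho_ge0 //.
  by rewrite le_max lexx.
apply: le_trans (abs_exp_term_le t j) _; apply: lerXn2r; rewrite ?nnegrE ?rho_ge0 //.
by rewrite le_max lexx orbT.
Qed.

Lemma expK0 : expK abs 0 = 1.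
Proof.
apply: limE; apply: (conv_eq (fun _ => 1) _ _ 1%N); last exact: conv_cst.
move=> -[|n] // _; rewrite big_ord_recl big1 ?addr0; last by move=> i _; rewrite expr0n mul0r.
by rewrite expr0 fact0 divr1.
Qed.

Lemma expK_natM n t : abs t < rexp -> expK abs (n%:R * t) = expK abs t ^+ n.
Proof.
move=> ht; elim: n => [|n IH]; first by rewrite mul0r expK0 expr0.
rewrite -add1n natrD mulrDl mul1r expKD ?IH ?exprS //.
by rewrite (absM HK); apply: le_lt_trans ht; rewrite ler_piMl ?abs_nneg // abs_nat.
Qed.

Lemma expKN t : abs t < rexp -> expK abs (- t) * expK abs t = 1.
Proof. by move=> ht; rewrite -expKD ?absN // addNr expK0. Qed.

Lemma expK_sub1 t : abs t < rexp -> abs (expK abs t - 1) <= abs t.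
Proof.
move=> ht; have [->|t0] := eqVneq t 0; first by rewrite expK0 subrr.
apply: (conv_le_lim _ _ _ _ 1%N (expK_conv _ ht)); first by rewrite abs_gt0.
move=> -[|n] // _; rewrite big_ord_recl expr0 fact0 divr1 addrAC subrr add0r.
apply: abs_sum_le => [|i _]; first exact: abs_nneg.
apply: le_trans (abs_exp_term t i) _; rewrite ler_piMr ?abs_nneg //.
by apply: exprn_ile1; [exact: rho_ge0 | exact/ltW/rho_lt1].
Qed.

Lemma expK_second t N : abs t < rexp ->
  abs (expK abs ((p ^ N)%:R * t) - 1 - (p ^ N)%:R * t) <= rad N ^+ 2.
Proof.
move=> ht; have rN := rad_gt0 N; have rN1 := rad_le1 N.
have hP : abs ((p ^ N)%:R * t) < rexp.
  by rewrite (absM HK); apply: le_lt_trans ht; rewrite ler_piMl ?abs_nneg // abs_nat.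
rewrite -addrA -opprD; apply: (conv_le_lim _ _ _ _ 2%N (expK_conv _ hP)); first by rewrite exprn_gt0.
move=> -[|[|n]] // _; rewrite !big_ord_recl /= expr0 fact0 divr1 expr1 divr1.
rewrite (_ : _ + _ - _ = \sum_(i < n) ((p ^ N)%:R * t) ^+ (bump 0 (bump 0 i)) /
  ((bump 0 (bump 0 i))`!)%:R); last by ring.
apply: abs_sum_le => [|i _]; first by rewrite exprn_ge0 // ltW.
rewrite /bump /= !add1n exprMn -mulrA -[rad N ^+ 2]mulr1; apply: absM_le.
  by rewrite absX abs_pXn; apply: ler_wiXn2l => //; exact: ltW.
apply: le_trans (abs_exp_term_le t _) _.
by apply: exprn_ile1; [exact: rho_ge0 | exact/ltW/rho_lt1].
Qed.

Definition logS (v : K) (n : nat) : K := \sum_(k < n) (-1) ^+ k * (v ^+ k.+1 / k.+1%:R).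

Lemma logK_conv v : abs v < rexp -> conv (logS v) (logK abs (1 + v)).
Proof.
move=> hv; have [l hl] : exists l, conv (logS v) l.
  apply: (geo_series (fun k => (-1) ^+ k * (v ^+ k.+1 / k.+1%:R)) _ (abs v) (rho_ge0 v) (rho_lt1 v hv)) => k.
  rewrite (absM HK) absX absN abs1 expr1n mul1r; exact: abs_log_term.
rewrite (_ : logK abs (1 + v) = l) //; apply: limE; apply/(conv_shift _ _ 1).
apply: (conv_eq _ _ _ 0%N _ hl) => n _; rewrite addn1 big_add1 /= big_mkord.
by apply: eq_bigr => k _; rewrite [1 + v]addrC addrK -mulrA !exprS; ring.
Qed.

Lemma abs_lead (a : nat -> K) (r : R) n : 0 <= r -> r < 1 ->
  (forall k, abs (a k.+1) <= r * abs (a 0%N)) -> abs (\sum_(k < n.+1) a k) = abs (a 0%N).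
Proof.
move=> r0 r1 h; rewrite big_ord_recl; have [a0|a0] := eqVneq (a 0%N) 0.
  rewrite a0 add0r big1 // => i _; apply/(abs_eq0 HK); apply/eqP; rewrite eq_le abs_nneg andbT.
  by apply: le_trans (h i) _; rewrite a0 abs0 mulr0.
rewrite absD_gt //; apply: (@le_lt_trans _ _ (r * abs (a 0%N))).
  by apply: abs_sum_le => [|i _]; [rewrite mulr_ge0 ?abs_nneg | apply: h].
by rewrite -[X in _ < X]mul1r ltr_pM2r // abs_gt0.
Qed.

(** The first term dominates strictly. Used with c k = (-1)^k for log (1 + v), and with c k =
    binom(p^N - 1, k) for ((1 + v)^(p^N) - 1) / p^N. *)
Lemma abs_log_tail (c : nat -> K) v n : abs v < rexp -> c 0%N = 1 -> (forall k, abs (c k) <= 1) ->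
  abs (\sum_(k < n.+1) c k * (v ^+ k.+1 / k.+1%:R)) = abs v.
Proof.
move=> hv c0 hc.
rewrite (abs_lead (fun k => c k * (v ^+ k.+1 / k.+1%:R)) _ _ (rho_ge0 v) (rho_lt1 v hv)).
  by rewrite c0 mul1r expr1 divr1.
move=> k; rewrite c0 mul1r expr1 divr1 -[X in _ <= X]mul1r; apply: absM_le => //.
apply: le_trans (abs_log_term v k.+1) _; rewrite mulrC; apply: ler_wpM2r; first exact: abs_nneg.
rewrite exprS ler_piMr ?rho_ge0 // exprn_ile1 ?rho_ge0 //; exact/ltW/rho_lt1.
Qed.

Lemma abs_logK v : abs v < rexp -> abs (logK abs (1 + v)) = abs v.
Proof.
move=> hv; have tail n : abs (logS v n.+1) = abs v.
  by apply: abs_log_tail => // k; rewrite absX absN abs1 expr1n.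
set l := logK _ _; have cv := logK_conv v hv; rewrite -/l in cv.
have [v0|v0] := eqVneq v 0.
  suff -> : l = 0 by rewrite v0.
  apply/abs_le0 => e e0; rewrite -[l]subr0; apply: (conv_le_lim _ _ _ _ 1%N cv e0).
  by move=> -[|n] // _; rewrite subr0 tail v0 abs0 ltW.
have a0 : 0 < abs v by rewrite abs_gt0.
have [N hN] := cv _ a0; have := hN N.+1 (leqnSn N).
by rewrite absBC -(tail N) => h; rewrite -(subrK (logS v N.+1) l) addrC absD_gt.
Qed.

Lemma pow_sub1 v N : (1 + v) ^+ (p ^ N) - 1 =
  (p ^ N)%:R * \sum_(k < p ^ N) binK ((p ^ N)%:R - 1 : K) k * (v ^+ k.+1 / k.+1%:R).
Proof.
rewrite [1 + v]addrC exprD1n big_ord_recl expr0 bin0 mulr1n addrAC subrr add0r mulr_sumr.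
apply: eq_bigr => k _; rewrite lift0.
have -> : (p ^ N)%:R - 1 = ((p ^ N).-1)%:R :> K.
  by rewrite -[in LHS](prednK (pXn_gt0 N)) -natr1 addrK.
rewrite binK_nat -mulr_natl.
have : (p ^ N)%:R * ('C((p ^ N).-1, k))%:R = k.+1%:R * ('C(p ^ N, k.+1))%:R :> K.
  by rewrite -!natrM mul_bin_diag.
move=> e; rewrite mulrA e; field.
by rewrite addrC natr1 natK_neq0.
Qed.

Lemma binK_pred_le N k : abs (binK ((p ^ N)%:R - 1) k : K) <= 1.
Proof.
rewrite (_ : (p ^ N)%:R - 1 = ((p ^ N).-1)%:R :> K) ?binK_nat ?abs_nat //.
by rewrite -[in LHS](prednK (pXn_gt0 N)) -natr1 addrK.
Qed.

Lemma abs_pow_sub1 v N : abs v < rexp -> abs ((1 + v) ^+ (p ^ N) - 1) = rad N * abs v.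
Proof.
move=> hv; rewrite pow_sub1 (absM HK) abs_pXn; congr (_ * _).
rewrite -(prednK (pXn_gt0 N)); apply: (abs_log_tail (binK ((p ^ N).-1.+1%:R - 1))) => //.
  by rewrite /binK big_ord0 fact0 divr1.
by move=> k; rewrite (prednK (pXn_gt0 N)); apply: binK_pred_le.
Qed.

(** By [pow_sub1] both sides are series in v^(k+1) / (k+1), with coefficients binom(p^N - 1, k) and
    (-1)^k = binom(-1, k). As p^N - 1 tends to -1, finitely many coefficients are close, and the
    tails decay geometrically. *)
Lemma log_lim v : abs v < rexp ->
  conv (fun N => ((1 + v) ^+ (p ^ N) - 1) / (p ^ N)%:R) (logK abs (1 + v)).
Proof.
move=> hv.
suff h : conv (fun N => ((1 + v) ^+ (p ^ N) - 1) / (p ^ N)%:R - logS v (p ^ N)) 0.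
  have hl : conv (fun N => logS v (p ^ N)) (logK abs (1 + v)).
    move=> e e0; have [N hN] := logK_conv v hv e e0; exists N => n nN; apply: hN.
    apply: leq_trans nN _; apply/ltnW/ltn_expl/prime_gt1 => //.
  have := convD _ _ _ _ h hl; rewrite add0r; apply: (conv_eq _ _ _ 0%N) => n _.
  by rewrite subrK.
apply: convI0 => e e0.
have v0 := abs_nneg v; have v1 := abs_lt1 v hv.
have [k0 hk0] := geo_small _ e (rho_ge0 v) (rho_lt1 v hv) e0.
have [B [B0 hB]] := bigmax_bound (fun k => (abs (k`!)%:R)^-1) k0.
have [N1 hN1] := rad_small (e / B) (divr_gt0 e0 B0).
exists N1 => N nN; rewrite pow_sub1 mulrC mulKf ?pXn_neq0 // /logS -sumrB.
apply: abs_sum_le => [|k _]; first exact: ltW.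
rewrite -mulrBl -binK_N1.
have bk : abs (v ^+ k.+1 / k.+1%:R) <= (abs v / rexp) ^+ k.
  apply: le_trans (abs_log_term v k) _; rewrite ler_piMl ?exprn_ge0 ?rho_ge0 //; exact: ltW.
have bk1 : (abs v / rexp) ^+ k <= 1.
  by apply: exprn_ile1; [exact: rho_ge0 | exact/ltW/rho_lt1].
case: (leqP k0 k) => hk.
  rewrite -[e]mul1r; apply: absM_le; last by apply: le_trans bk (hk0 _ hk).
  by apply: absB_le; [exact: binK_pred_le | rewrite binK_N1 absX absN abs1 expr1n].
rewrite -[e]mulr1; apply: absM_le; last exact: le_trans bk bk1.
have x1 : abs ((p ^ N)%:R - 1) <= 1 by apply: absB_le; rewrite ?abs_nat ?abs1.
apply: le_trans (binK_close _ (-1) k x1 _) _; first by rewrite absN abs1.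
rewrite opprK subrK abs_pXn.
apply: (@le_trans _ _ (e / B * B)); last by rewrite divfK ?gt_eqF.
by apply: ler_pM; rewrite ?rad_ge0 ?invr_ge0 ?abs_nneg //; [exact: hN1 | exact: hB].
Qed.

(* With r = exp (log q) / q, both exp (log q) ^ p^N and q ^ p^N are
   1 + p^N log q + o(p^N), whereas |r ^ p^N - 1| = |p^N| |r - 1|. *)
Lemma expK_logK q : abs (q - 1) < rexp -> expK abs (logK abs q) = q.
Proof.
move=> hq; set v := q - 1 in hq; have eq : q = 1 + v by rewrite /v addrCA subrr addr0.
set l := logK abs q; have hl : abs l < rexp by rewrite /l eq abs_logK.
set E := expK abs l.
have aq : abs q = 1 by rewrite eq absD_gt abs1 //; apply: abs_lt1.
have q0 : q != 0 by rewrite -abs_gt0 aq.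
have hE := expK_sub1 l hl; rewrite -/E in hE.
set u := E / q - 1.
have hu : abs u < rexp.
  rewrite (_ : u = ((E - 1) - v) / q); last by rewrite /u /v; field.
  rewrite (absM HK) absV aq invr1 mulr1; apply: absD_lt; rewrite ?absN //.
  exact: le_lt_trans hE hl.
suff : u = 0 by move/eqP; rewrite subr_eq0 => /eqP h; rewrite -[E](divfK q0) h mul1r.
apply: abs_le0 => e e0.
have cv := log_lim v hq; rewrite -eq -/l in cv.
have [N1 hN1] := conv_le _ _ _ cv e0.
have [N2 hN2] := rad_small e e0.
set N := maxn N1 N2; have rN := rad_gt0 N.
have := abs_pow_sub1 u N hu; rewrite [1 + u]addrC subrK expr_div_n => e1.
have h1 : abs (E ^+ (p ^ N) - 1 - (p ^ N)%:R * l) <= e * rad N.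
  rewrite /E -expK_natM //; apply: le_trans (expK_second l N hl) _.
  by rewrite expr2 ler_pM2r //; apply: hN2; apply: leq_maxr.
have h2 : abs (q ^+ (p ^ N) - 1 - (p ^ N)%:R * l) <= e * rad N.
  have := hN1 N (leq_maxl _ _); set w := (X in abs X <= _) => hw.
  rewrite (_ : _ - _ = w * (p ^ N)%:R); last by rewrite /w; field; rewrite pXn_neq0.
  by apply: absM_le => //; rewrite abs_pXn.
have h3 := absB_le _ _ _ h1 h2.
rewrite -(ler_pM2l rN) [rad N * e]mulrC -e1.
rewrite (_ : _ - 1 = (E ^+ (p ^ N) - q ^+ (p ^ N)) / q ^+ (p ^ N)); last first.
  by field; rewrite expf_neq0.
rewrite (absM HK) absV absX aq expr1n invr1 mulr1.
by move: h3; congr (abs _ <= _); ring.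
Qed.

(** * Antiderivatives of continuous functions *)

Lemma udiff_ucont f f' : udiff f f' -> ucont f.
Proof.
move=> hf; have [B [B0 hB]] := scont_bound _ (proj1 (udiff_nat _ _ hf)).
have [k1 h1] := proj1 hf 1 ltr01; have [k2 h2] := proj2 hf 1 ltr01.
move=> e e0; have C0 : 0 < B + 1 by lra.
have [k3 h3] := rad_small (e / (B + 1)) (divr_gt0 e0 C0).
exists (maxn k2 k3) => x y hx hy hxy.
have q2 := le_trans hxy (rad_le _ _ (leq_maxl k2 k3)).
have q3 := le_trans hxy (h3 _ (leq_maxr k2 k3)).
have fb : abs (f' x) <= B + 1.
  rewrite -(subrK (f' (tr k1 x)%:R) (f' x)); apply: absD_le; last by apply: le_trans (hB _) _; lra.
  by apply: le_trans (h1 _ _ hx (Zp_nat _) (abs_tr k1 x hx)) _; lra.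
have d0 := abs_nneg (x - y).
have le : (B + 1) * abs (x - y) <= e by rewrite mulrC -ler_pdivlMr.
rewrite -(subrK ((x - y) * f' x) (f x - f y)); apply: absD_le; apply: le_trans le.
  by apply: le_trans (h2 _ _ hx hy q2) _; apply: ler_wpM2r => //; lra.
by rewrite mulrC; apply: absM_le.
Qed.

(** Partial sums of the classical p-adic antiderivation: h at the n-th truncation of z times the
    increment to the next truncation. *)
Definition stair (h : K -> K) (n : nat) (z : K) : K :=
  \sum_(k < n) h (tr k z)%:R * ((tr k.+1 z)%:R - (tr k z)%:R).

Lemma abs_trB k m z : Zp z -> (k <= m)%N -> abs ((tr m z)%:R - (tr k z)%:R) <= rad k.
Proof.
move=> hz km; apply: (abs_chain z); last exact: abs_tr.
by rewrite absBC; apply: le_trans (abs_tr m z hz) (rad_le _ _ km).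
Qed.

Lemma ucont_nat h : ucont h -> scont (fun n => h n%:R).
Proof. by move=> hh e /hh [k hk]; exists k => x y; apply: hk; apply: Zp_nat. Qed.

(* The antiderivative is the limit of stair h n: near z all h (tr k x) are close
   to h z, so beyond level N the sum is about h z * (x - tr N x). *)
Lemma antiderivative h : ucont h -> exists F, forall z, Zp z -> UD_at abs F z (h z).
Proof.
move=> hh; have [B [B0 hB]] := scont_bound _ (ucont_nat _ hh).
pose F z := lim_seq abs (fun n => stair h n z).
have cv z : Zp z -> conv (fun n => stair h n z) (F z).
  move=> hz; apply: lim_conv; apply: cauchy_conv => e e0.
  have [N hN] := rad_small (e / B) (divr_gt0 e0 B0); exists N => n nN.
  rewrite /stair big_ord_recr /= addrAC subrr add0r.
  apply: le_trans (absM_le _ _ _ _ (hB _) (abs_trB _ _ z hz (leqnSn n))) _.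
  by rewrite mulrC -ler_pdivlMr //; apply: hN.
exists F => z hz e e0; have p0 := pR_gt0.
have [e1 [e10 e1E]] : exists e1, 0 < e1 /\ e1 * p%:R < e.
  by exists (e / 2 / p%:R); rewrite divfK ?gt_eqF // !divr_gt0 //; split=> //; lra.
have [k hk] := hh e1 e10.
exists (rad k); split; first exact: rad_gt0.
have near x N : Zp x -> abs (x - z) <= rad k -> (k <= N)%N ->
    abs (F x - stair h N x - h z * (x - (tr N x)%:R)) <= e1 * rad N.
  move=> hx hxz kN.
  have cx := convB _ _ _ _ (convB _ _ _ _ (cv x hx) (conv_cst (stair h N x)))
    (convZ _ _ (h z) (convB _ _ _ _ (tr_cvg x hx) (conv_cst (tr N x)%:R))).
  have e20 : 0 < e1 * rad N by rewrite mulr_gt0 // rad_gt0.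
  rewrite -[_ - _ * _]subr0; apply: (conv_le_lim _ _ _ _ N cx e20) => n Nn; rewrite subr0.
  rewrite -(subnKC Nn); elim: (n - N)%N => [|m IH].
    by rewrite addn0 !subrr mulr0 subrr abs0 ltW.
  have kNm : (k <= N + m)%N by apply: leq_trans kN (leq_addr _ _).
  rewrite addnS /stair big_ord_recr /= -/(stair h (N + m) x) -/(stair h N x).
  set a := (tr (N + m).+1 x)%:R; set b := (tr (N + m) x)%:R in IH *.
  have -> : stair h (N + m) x + h b * (a - b) - stair h N x - h z * (a - (tr N x)%:R) =
    (stair h (N + m) x - stair h N x - h z * (b - (tr N x)%:R)) + (h b - h z) * (a - b) by ring.
  apply: absD_le => //; apply: absM_le.
    apply: hk => //; first exact: Zp_nat.
    apply: abs_chain hxz; rewrite absBC.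
    by apply: le_trans (abs_tr _ x hx) (rad_le _ _ kNm).
  by apply: le_trans (abs_trB _ _ x hx (leqnSn _)) (rad_le _ _ (leq_addr _ _)).
move=> x y hx hy xy hxz hyz.
have nz : x - y != 0 by rewrite subr_eq0.
have xyk : abs (x - y) <= rad k by apply: (abs_chain z); [exact: ltW | rewrite absBC; apply: ltW].
have [N [kN xN pN]] := abs_level k (x - y) nz xyk.
have trE m : (m <= N)%N -> tr m x = tr m y.
  by move=> mN; apply: tr_close => //; apply: le_trans xN (rad_le _ _ mN).
have sE : stair h N x = stair h N y.
  by apply: eq_bigr => i _; rewrite !trE // ltnW.
have := absB_le _ _ _ (near x N hx (ltW hxz) kN) (near y N hy (ltW hyz) kN).
rewrite sE trE // => bound.
have -> : (F x - F y) / (x - y) - h z = (F x - F y - h z * (x - y)) / (x - y) by field.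
have a0 : 0 < abs (x - y) by rewrite abs_gt0.
rewrite (absM HK) absV ltr_pdivrMr //.
apply: (@le_lt_trans _ _ (e1 * rad N)).
  by move: bound; congr (abs _ <= _); ring.
by apply: (@le_lt_trans _ _ (e1 * (p%:R * abs (x - y)))); rewrite ?ler_pM2l // mulrA ltr_pM2r.
Qed.

Lemma antiderP h : ucont h -> UD abs (antider abs h) /\
  forall x, Zp x -> derivK abs (antider abs h) x = h x.
Proof.
move=> hh; apply: (epsilon_spec (inhabits (fun _ => 0))
  (fun F => UD abs F /\ forall x, Zp x -> derivK abs F x = h x)).
have [F hF] := antiderivative h hh; exists F; split=> x hx; first by exists (h x); apply: hF.
by apply: derivK_eq => //; apply: hF.
Qed.

(** * The q-convolution *)

Section QConvolution.
Variable q : K.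
Hypothesis q_close : abs (q - 1) < rexp.
Hypothesis q_neq1 : q != 1.

Lemma abs_logq : abs (logK abs q) = abs (q - 1).
Proof. by have := abs_logK _ q_close; rewrite addrCA subrr addr0. Qed.

Lemma logq_neq0 : logK abs q != 0.
Proof. by rewrite -abs_gt0 abs_logq abs_gt0 subr_eq0. Qed.

Lemma q_neq0 : q != 0.
Proof.
by rewrite -abs_gt0 -(subrK 1 q) addrC absD_gt abs1 ?ltr01 //; apply: abs_lt1.
Qed.

Lemma qpow_nat n : qpow abs q n%:R = q ^+ n.
Proof. by rewrite /qpow expK_natM ?expK_logK // abs_logq. Qed.

Lemma qpow_natN n : qpow abs q (- n%:R) * q ^+ n = 1.
Proof.
rewrite -qpow_nat /qpow mulNr; apply: expKN; rewrite (absM HK) abs_logq.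
by apply: le_lt_trans q_close; rewrite ler_piMl ?abs_nneg // abs_nat.
Qed.

Let c := (q - 1) / logK abs q.

Lemma qbr_conv : conv (fun N => (p ^ N)%:R / qbr abs q (p ^ N)%:R) c.
Proof.
have E : q = 1 + (q - 1) by rewrite addrCA subrr addr0.
have := log_lim _ q_close; rewrite -E => hl.
have := convZ _ _ (q - 1) (convV _ _ logq_neq0 hl).
apply: (conv_eq _ _ _ 0%N) => N _; rewrite /qbr qpow_nat.
(* The exact size p^-N times that of q - 1 shows that [p^N] does not vanish. *)
have qP : q ^+ (p ^ N) - 1 != 0.
  rewrite -abs_gt0 [in X in X ^+ _]E abs_pow_sub1 // mulr_gt0 ?rad_gt0 //.
  by rewrite abs_gt0 subr_eq0.
have q1 : q - 1 != 0 by rewrite subr_eq0.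
rewrite -[1 - q]opprB -[1 - q ^+ _]opprB; field.
by rewrite qP !oppr_eq0 q1 qP pXn_neq0.
Qed.

(** In both uses the integrand contains q^-x, from alpha = w / q or from the formula itself; it
    cancels the weight q^x and leaves a Volkenborn integral. *)
Lemma qint_vol h u l : (forall x : nat, h x%:R * q ^+ x = u x) -> conv (vol u) l ->
  qint abs p q h = c * l.
Proof.
move=> hu hl; apply: limE; have := convM _ _ _ _ qbr_conv hl.
apply: (conv_eq _ _ _ 0%N) => N _.
rewrite (eq_bigr (fun x : 'I_(p ^ N) => u x)); last by move=> x _; rewrite qpow_nat hu.
by rewrite /vol [LHS]mulrC mulrA divfK // pXn_neq0.
Qed.

Lemma fhat_root N w f f' : w ^+ (p ^ N) = 1 -> udiff f f' ->
  fhat abs p q f (w / q) = c * hat N (block (fun x => f x%:R) N) w.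
Proof.
move=> hw hf; apply: (qint_vol _ (fun x => w ^+ x * f x%:R)).
  move=> x; rewrite phi_nat expr_div_n mulrAC divfK //.
  by rewrite expf_neq0 // q_neq0.
exact: vol_root_conv hw (udiff_nat _ _ hf).
Qed.

Lemma qconv_lim f f' g g' z l : udiff f f' -> udiff g g' -> Zp z ->
  conv (fun N => cyc (p ^ N) (fun x => f x%:R) (fun x => g x%:R) (tr N z) / (p ^ N)%:R) l ->
  qconv abs p q f g z = c ^+ 2 * l.
Proof.
move=> hf hg hz hl; apply: limE.
have := hat_cyc_conv _ _ _ _ (fun N => tr N z) (udiff_nat _ _ hf) (udiff_nat _ _ hg)
  (fun N => tr_lt N z hz).
move=> h; have := convZ _ _ (c ^+ 2) (convD _ _ _ _ h hl); rewrite add0r.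
apply: (conv_eq _ _ _ 0%N) => N _; rewrite subrK mulr_sumr.
apply: eq_big_seq => w; have [_ hr] := roots_pnP N; move=> /hr hw.
rewrite (fhat_root N w f f') // (fhat_root N w g g') // (phi_root N) //; last first.
  by rewrite exprVn hw invr1.
by ring.
Qed.

(** Only f' and g' occur in the derivative, so [qotimes] does not depend on the antiderivatives that
    [antider] selects. *)
Lemma qconv_deriv f f' g g' z : udiff f f' -> udiff g g' -> Zp z ->
  UD_at abs (qconv abs p q f g) z
    (- (c ^+ 2 * ext (convol (fun x => f' x%:R) (fun x => g' x%:R)) z)).
Proof.
move=> hf hg hz; set T := convol _ _.
have sf := udiff_nat _ _ hf; have sg := udiff_nat _ _ hg.
have cT : scont T by apply: convol_scont; [case: sf | case: sg].
pose T2 n := c ^+ 2 * T n.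
have cT2 : scont T2.
  apply: (scontM (fun _ => c ^+ 2)) => // e e0.
  by exists 0%N => x y _; rewrite subrr abs0 ltW.
have -> : c ^+ 2 * ext T z = ext T2 z.
  exact: conv_uniq (convZ _ _ (c ^+ 2) (ext_conv T z cT hz)) (ext_conv T2 z cT2 hz).
apply: (UD_at_lim (fun M n => c ^+ 2 * (cyc (p ^ M) (fun x => f x%:R) (fun x => g x%:R) n
   / (p ^ M)%:R))) => //.
  move=> x hx; have [V _ hV] := cyc_conv _ _ _ _ x hf hg hx.
  rewrite (qconv_lim f f' g g' x _ hf hg hx hV); exact: convZ.
move=> e e0; have a0 := abs_nneg (c ^+ 2).
have C0 : 0 < abs (c ^+ 2) + 1 by lra.
have [N0 h] := cyc_deriv _ _ _ _ sf sg _ (divr_gt0 e0 C0).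
exists N0 => N M n n0 NM hn; have := h N M n n0 NM hn; rewrite -/T.
set X := (X in abs X <= _) => hX.
rewrite (_ : _ + _ = c ^+ 2 * X); last by rewrite /X /T2 mulrBl; ring.
apply: le_trans (absM_le _ _ _ _ (lexx _) hX) _.
have rN := rad_gt0 N; rewrite mulrA; apply: ler_wpM2r; first exact: ltW.
by rewrite mulrCA ler_piMr ?(ltW e0) // ler_pdivrMr // mul1r; lra.
Qed.

Lemma qconv_formula f g z : UD abs f -> UD abs g -> Zp z ->
  qconv abs p q f g z =
    (q - 1) / logK abs q
      * qint abs p q (fun x => f x * g (z - x) * qpow abs q (- x))
    - qotimes abs p q f (derivK abs g) z.
Proof.
move=> /UD_udiff hf /UD_udiff hg hz; rewrite -/c.
have [V hV hW] := cyc_conv _ _ _ _ z hf hg hz.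
rewrite (qconv_lim _ _ _ _ _ _ hf hg hz hW).
rewrite (qint_vol _ (fun x => f x%:R * g (z - x%:R)) V) //; last first.
  by move=> x; rewrite -mulrA qpow_natN mulr1.
have [/UD_udiff uF dF] := antiderP f (udiff_ucont _ _ hf).
have [/UD_udiff uG dG] := antiderP (derivK abs g) (proj1 hg).
rewrite /qotimes (derivK_eq _ _ _ hz (qconv_deriv _ _ _ _ _ uF uG hz)).
(* The antiderivatives have the prescribed derivatives only on Z_p, which suffices as [convol]
   evaluates at naturals. *)
have -> : convol (fun x => derivK abs (antider abs f) x%:R)
    (fun x => derivK abs (antider abs (derivK abs g)) x%:R) =
  convol (fun x => f x%:R) (fun x => derivK abs g x%:R).
  apply: functional_extensionality => n; apply: eq_bigr => a _.
  by rewrite dF ?dG //; apply: Zp_nat.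
by rewrite opprK; ring.
Qed.
End QConvolution.

End PadicAnalysis.

Theorem theorem2 (R : realType) (K : closedFieldType) (abs : K -> R) (p : nat)
  (q : K) (f g : K -> K) :
  prime p -> Cp_axioms abs p ->
  abs (q - 1) < (p%:R : R) `^ (- (p%:R - 1)^-1) -> q != 1 ->
  UD abs f -> UD abs g ->
  forall z : K, isZp abs z ->
    qconv abs p q f g z =
      (q - 1) / logK abs q
        * qint abs p q (fun x => f x * g (z - x) * qpow abs q (- x))
      - qotimes abs p q f (derivK abs g) z.
Proof.
move=> p_prime HK hq q1 hf hg z hz.
exact: (qconv_formula p_prime HK _ hq q1).
Qed.
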